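(* Let $g>1$ be an integer and let $K$ be an algebraically closed field. Suppose that one of the following conditions holds: (a) $\mathrm{char}(K)=0$; (b) $q=2g+1$ is a prime, and $p:=\mathrm{char}(K)$ is an odd prime that is a primitive root modulo $q$. Then there exists a finite (possibly empty) set $S(g,K)$ of marked genus $g$ odd degree hyperelliptic curves over $K$ with the following properties: (1) $\#(S(g,K)) \le 9(4g-1)\binom{2g}{g}^2$. (2) If $(\mathcal{C},\infty)$ is a marked genus $g$ odd degree hyperelliptic curve over $K$ (with marked Weierstrass point $\infty$) such that $\#(\mathcal{C}_{2g+1}^{*}(K))>4$, then $(\mathcal{C},\infty)$ is isomorphic (as a marked curve over $K$) to one of the marked curves in $S(g,K)$.
   Context: Let $K$ be an algebraically closed field of characteristic $\neq 2$. A marked genus $g$ odd degree hyperelliptic curve over $K$ is a pair $(\mathcal{C},\mathcal{O})$, where $\mathcal{C}$ is a smooth irreducible projective hyperelliptic curve of genus $g>1$ over $K$ and $\mathcal{O}\in\mathcal{C}(K)$ is one of its $2g+2$ Weierstrass points (the fixed points of the hyperelliptic involution). An isomorphism of marked curves is a biregular isomorphism over $K$ that sends marked point to marked point. Every such pair is isomorphic to $(\mathcal{C}_f,\infty)$, where $f(x)\in K[x]$ is a polynomial of degree $2g+1$ without repeated roots, $\mathcal{C}_f$ is the smooth projective model of the affine curve $y^2=f(x)$, and $\infty$ is its unique point at infinity. Let $J$ be the jacobian of $\mathcal{C}$. The curve $\mathcal{C}$ is embedded in $J$ by sending $P\in\mathcal{C}(K)$ to the linear equivalence class of the divisor $(P)-(\mathcal{O})$;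 in this way $\mathcal{C}(K)$ is regarded as a subset of the group $J(K)$. For a positive integer $d$, $\mathcal{C}_{d}^{*}(K)$ denotes the set of points of $\mathcal{C}(K)$ that have order exactly $d$ in the group $J(K)$. *)

(* Defs.v *)
From HB Require Import structures.
From mathcomp Require Import all_boot all_order all_algebra.
From mathcomp Require Import ring_quotient boolp classical_sets cardinality.
From mathcomp.multinomials Require Import freeg.

Set Implicit Arguments.
Unset Strict Implicit.
Unset Printing Implicit Defensive.

Import Order.TTheory GRing.Theory Num.Theory.
Local Open Scope classical_set_scope.
Local Open Scope ring_scope.

Definition primitive_root_mod (p q : nat) : Prop :=
  coprime p q /\ forall a, coprime a q -> exists k, (p ^ k = a %[mod q])%N.

(* In an additive group x *+ d is d.x; mathcomp's #[x] only covers finite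
   groups. *)
Definition has_order (V : zmodType) (x : V) (d : nat) : Prop :=
  [/\ (0 < d)%N, x *+ d = 0 & forall m, (0 < m < d)%N -> x *+ m != 0].

Section FunctionField.
Variables (K : closedFieldType) (F : fieldType) (c : {rmorphism K -> F}).

Definition transcendental (x : F) : Prop :=
  forall p : {poly K}, p != 0 -> (map_poly c p).[x] != 0.

Definition ratfun_in (x : F) : set F :=
  [set h | exists p q : {poly K},
    (map_poly c q).[x] != 0 /\ h = (map_poly c p).[x] / (map_poly c q).[x]].

(* F is a finite extension of K(x) for some x transcendental over K. *)
Definition is_function_field : Prop :=
  exists2 x, transcendental x &
  exists n (e : 'I_n -> F), forall h, exists2 r : 'I_n -> F,
    (forall i, ratfun_in x (r i)) & h = \sum_(i < n) r i * e i.

(* The normalized discrete valuations of F that are trivial on K.  The junk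
   value at 0 (where the valuation is infinite) is fixed to be 0, so that equal
   valuations are equal functions. *)
Definition is_place (v : F -> int) : Prop :=
  [/\ v 0 = 0,
      forall a, v (c a) = 0,
      {in [pred h : F | h != 0] &, {morph v : h k / h * k >-> h + k}},
      forall h k : F, h != 0 -> k != 0 -> h + k != 0 ->
        Num.min (v h) (v k) <= v (h + k) &
      exists2 t : F, t != 0 & v t = 1].

End FunctionField.

(* A smooth irreducible projective curve over the algebraically closed field K,
   encoded by its function field: smooth projective curves and biregular
   isomorphisms are (contravariantly) the function fields of transcendence
   degree 1 over K and their K-isomorphisms, and the K-points of the curve are
   the discrete valuations of its function field, P being sent to ord_P. *)
Record curve (K : closedFieldType) := Curve {
  funfield :> fieldType;
  cst : {rmorphism K -> funfield};
  _ : is_function_field cst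
}.

Record point (K : closedFieldType) (C : curve K) := Point {
  ord :> C -> int;
  _ : is_place (cst C) ord
}.

HB.instance Definition _ K C := gen_eqMixin (@point K C).
HB.instance Definition _ K C := gen_choiceMixin (@point K C).

Section Curve.
Variables (K : closedFieldType) (C : curve K).

Local Notation divisor := {freeg (point C) / int}.

Definition is_principal (D : divisor) : Prop :=
  exists2 h : C, h != 0 & forall P : point C, coeff P D = P h.

Definition RRspace (D : divisor) : set C :=
  [set h : C | h = 0 \/ forall P : point C, 0 <= coeff P D + P h].

Definition K_dim (L : set C) (n : nat) : Prop :=
  exists2 e : 'I_n -> C, (forall i, L (e i)) &
    forall h, L h -> exists! a : {ffun 'I_n -> K},
      h = \sum_(i < n) cst C (a i) * e i.

(* The genus is the maximum of deg D + 1 - dim L(D) over all divisors D, where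
   L(D) is RRspace D; every point has degree 1 as K is algebraically closed. *)
Definition has_genus (g : nat) : Prop :=
  (forall D n, K_dim (RRspace D) n -> deg D + 1 - n%:Z <= g%:Z) /\
  (exists D n, K_dim (RRspace D) n /\ deg D + 1 - n%:Z = g%:Z).

(* Pullback of functions along an involution of C whose quotient curve is the
   projective line: the functions it fixes form a rational field K(x). *)
Definition hyperelliptic_involution (s : {rmorphism C -> C}) : Prop :=
  [/\ forall a, s (cst C a) = cst C a,
      involutive s,
      exists h, s h != h &
      exists2 x, transcendental (cst C) x &
        [set h | s h = h] = ratfun_in (cst C) x].

Definition weierstrass_point (P : point C) : Prop :=
  exists2 s : {rmorphism C -> C},
    hyperelliptic_involution s & forall h, P (s h) = P h.

Definition degree_zero : {pred divisor} := [pred D | deg D == 0].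

Fact degree_zero_zmod_closed : zmod_closed degree_zero.
Proof.
split=> [|D E]; rewrite !inE ?deg0 //.
by rewrite degB => /eqP-> /eqP->; rewrite subr0.
Qed.
HB.instance Definition _ := GRing.isZmodClosed.Build divisor degree_zero
  degree_zero_zmod_closed.

Record div0 := Div0 { div0_val :> divisor; _ : div0_val \in degree_zero }.
HB.instance Definition _ := [isSub for div0_val].
HB.instance Definition _ := [Choice of div0 by <:].
HB.instance Definition _ := [SubChoice_isSubZmodule of div0 by <:].

Definition principal0 : {pred div0} := [pred D | `[< is_principal (val D) >]].

Fact ordV (P : point C) h : h != 0 -> P h^-1 = - P h.
Proof.
case: P => v /= [_ v_cst vM _ _] h0; apply/eqP; rewrite -addr_eq0 addrC.
rewrite -vM ?inE ?invr_eq0 ?mulfV //; apply/eqP.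
by have := v_cst 1; rewrite rmorph1.
Qed.

Fact principal0_zmod_closed : zmod_closed principal0.
Proof.
split=> [|D E]; rewrite !inE.
  exists 1; first exact: oner_neq0.
  case=> v vP /=; rewrite coeff0; have [_ v_cst _ _ _] := vP.
  by rewrite -(rmorph1 (cst C)) v_cst.
move=> [h h0 hD] [k k0 kE]; exists (h / k).
  by rewrite mulf_neq0 ?invr_eq0.
move=> P; rewrite GRing.valB coeffB hD kE -ordV //.
by case: P {hD kE} => v /= [_ _ vM _ _]; rewrite vM ?inE ?invr_eq0.
Qed.
HB.instance Definition _ := GRing.isZmodClosed.Build div0 principal0
  principal0_zmod_closed.

(* The group J(K) of K-points of the jacobian: divisor classes of degree 0. *)
Definition jacobian := Quotient.quot principal0.
HB.instance Definition _ := GRing.Zmodule.on jacobian.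

Definition point_diff (P O : point C) : divisor := << P >> - << O >>.

Fact point_diff_degree_zero P O : point_diff P O \in degree_zero.
Proof. by rewrite inE degB !degU subrr. Qed.

Definition abel_jacobi (O P : point C) : jacobian :=
  \pi_jacobian%qT (Div0 (point_diff_degree_zero P O)).

Definition points_of_order (O : point C) (d : nat) : set (point C) :=
  [set P | has_order (abel_jacobi O P) d].

End Curve.

Record marked_curve (K : closedFieldType) (g : nat) := MarkedCurve {
  mcurve :> curve K;
  mpoint : point mcurve;
  _ : has_genus mcurve g;
  _ : weierstrass_point mpoint
}.

(* A biregular isomorphism C1 -> C2 is given by the K-isomorphism s from the
   function field of C2 to that of C1 (pullback); it sends the marked point O1
   to the point whose valuation is ord_O1 \o s. *)
Definition marked_iso (K : closedFieldType) (g : nat)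
    (C1 C2 : marked_curve K g) : Prop :=
  exists s : {rmorphism C2 -> C1},
    [/\ bijective s,
        forall a, s (cst C2 a) = cst C1 a &
        forall h, mpoint C1 (s h) = mpoint C2 h].

(* Main.v *)
Require Import Defs.
From HB Require Import structures.
From Stdlib Require List.
From mathcomp Require Import all_boot all_order all_algebra all_solvable all_field.
From mathcomp Require Import ring_quotient boolp classical_sets cardinality.
From mathcomp Require Import zify ring.
From mathcomp.multinomials Require Import freeg.

Set Implicit Arguments.
Unset Strict Implicit.
Unset Printing Implicit Defensive.

Import Order.TTheory GRing.Theory Num.Theory.

Local Notation point := Defs.point.

(** Write q = 2g+1.  A point of order q is the same as an expression
    f = (X - b)^q + v^2 with deg v <= g, because the function with divisor
    q(Q - oo) is a multiple of y - v(x) and its norm is a multiple of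
    (x - b)^q.  More than four such points give three values of b, which an
    affine change of x turns into 0, 1 and a.  Then
    (v2 - v1)(v2 + v1) = X^q - (X - 1)^q has the 2g simple roots
    1/(1 - e), e^q = 1 <> e, so v1 is a combination of the two monic polynomials
    attached to a splitting of these roots into halves, with prescribed product
    of the coefficients; after the substitution x -> a x the same holds for the
    points 0 and a.  For each of the C(2g, g)^2 pairs of splittings, eliminating the
    coefficients leaves a nonzero equation of degree 4g+1 for a, and each a
    allows at most two values of v1^2. *)

(** * Places of a curve *)

(** The curve is only a function field with its valuations, so the equation y^2 = f(x), the points
    above b and the equality of m with the genus all have to be extracted from valuations. Besides
    keeping 2 and q nonzero in [K], the condition on the characteristic serves one purpose: two
    values of v1^2 per a suffice unless X -> a X carries one half of the roots 1/(1 - e) to another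
    half, and this must force a = 1. Over the complex numbers that is plane geometry of circles,
    whose only algebraic ingredient is the inversion e -> e^-1 of roots of unity by a field
    automorphism. Complex conjugation provides it; in characteristic p the power p^k = -1 mod q of
    Frobenius does; general characteristic 0 is reduced to the complex numbers. The equation for a
    is nonzero because its leading coefficient is the square of a 2 x 2 minor that can be chosen
    nonzero: otherwise X^q - (X - 1)^q + d X^(2g) would be a square for some d. The resulting count
    2 (4g + 1) C(2g, g)^2 lies below the required bound. *)

Section Valuation.
Local Open Scope ring_scope.
Variables (K : closedFieldType) (C : curve K).
Implicit Types (Q : point C) (h k x : C).

Lemma place0 Q : Q 0 = 0.
Proof. by case: Q => v /= []. Qed.

Lemma place_cst Q a : Q (cst C a) = 0.
Proof. by case: Q => v /= []. Qed.

Lemma placeM Q h k : h != 0 -> k != 0 -> Q (h * k) = Q h + Q k.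
Proof. by case: Q => v /= [_ _ vM _ _] ? ?; rewrite /= vM. Qed.

Lemma placeD Q h k : h != 0 -> k != 0 -> h + k != 0 ->
  Num.min (Q h) (Q k) <= Q (h + k).
Proof. by case: Q => v /= [_ _ _ vD _] /=; apply: vD. Qed.

Lemma place_unif Q : exists2 t : C, t != 0 & Q t = 1.
Proof. by case: Q => v /= []. Qed.

Lemma place1 Q : Q 1 = 0.
Proof. by rewrite -(rmorph1 (cst C)) place_cst. Qed.

Lemma placeV Q h : Q h^-1 = - Q h.
Proof.
have [->|h0] := eqVneq h 0; first by rewrite invr0 place0 oppr0.
exact: ordV.
Qed.

Lemma placeX Q h n : Q (h ^+ n) = Q h *+ n.
Proof.
have [->|h0] := eqVneq h 0.
  by rewrite place0 mul0rn; case: n => [|n]; rewrite ?expr0 ?place1 ?expr0n ?place0.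
elim: n => [|n IH]; first by rewrite expr0 place1.
by rewrite exprS placeM ?expf_neq0 // IH mulrS.
Qed.

Lemma placeN Q h : Q (- h) = Q h.
Proof.
have [->|h0] := eqVneq h 0; first by rewrite oppr0.
rewrite -mulN1r placeM ?oppr_eq0 ?oner_eq0 //.
by rewrite -(rmorph1 (cst C)) -rmorphN place_cst add0r.
Qed.

(* The convention Q 0 = 0 makes n <= Q h the wrong notion for h = 0. *)
Definition vge Q (n : int) h := (h == 0) || (n <= Q h).

Lemma vge0 Q n : vge Q n 0. Proof. by rewrite /vge eqxx. Qed.

Lemma vgeE Q n h : h != 0 -> vge Q n h = (n <= Q h).
Proof. by rewrite /vge => /negbTE->. Qed.

Lemma vge_refl Q h : vge Q (Q h) h.
Proof. by rewrite /vge lexx orbT. Qed.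

Lemma vgeD Q n h k : vge Q n h -> vge Q n k -> vge Q n (h + k).
Proof.
have [->|h0] := eqVneq h 0; first by rewrite add0r.
have [->|k0] := eqVneq k 0; first by rewrite addr0.
have [->|hk0] := eqVneq (h + k) 0; first by rewrite vge0.
rewrite !vgeE // => hn kn; apply: le_trans (placeD Q h0 k0 hk0).
by rewrite le_min hn.
Qed.

Lemma vgeN Q n h : vge Q n (- h) = vge Q n h.
Proof. by rewrite /vge oppr_eq0 placeN. Qed.

Lemma vgeB Q n h k : vge Q n h -> vge Q n k -> vge Q n (h - k).
Proof. by move=> hn kn; rewrite vgeD ?vgeN. Qed.

Lemma vgeM Q n m h k : vge Q n h -> vge Q m k -> vge Q (n + m) (h * k).
Proof.
have [->|h0] := eqVneq h 0; first by move=> _ _; rewrite mul0r vge0.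
have [->|k0] := eqVneq k 0; first by move=> _ _; rewrite mulr0 vge0.
by rewrite !vgeE ?mulf_neq0 // placeM //; apply: lerD.
Qed.

Lemma vge_cst Q a : vge Q 0 (cst C a).
Proof. by rewrite /vge place_cst lexx orbT. Qed.

Lemma vge_le Q n m h : m <= n -> vge Q n h -> vge Q m h.
Proof. by move=> mn /orP[/eqP->|hn]; rewrite ?vge0 // /vge (le_trans mn) ?orbT. Qed.

Lemma vgeX Q h n : vge Q 0 h -> vge Q 0 (h ^+ n).
Proof.
move=> hQ; elim: n => [|n IH]; first by rewrite expr0 -(rmorph1 (cst C)) vge_cst.
by rewrite exprS -[0]addr0 vgeM.
Qed.

(** The case of equality in the ultrametric inequality: a larger value of [h + k] would pass to h =
    (h + k) - k. *)
Lemma place_dominant Q h k : h != 0 -> vge Q (Q h + 1) k ->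
  h + k != 0 /\ Q (h + k) = Q h.
Proof.
move=> h0 kQ; have hk0 : h + k != 0.
  apply: contraL kQ => /eqP/addr0_eq <-.
  by rewrite vgeN vgeE //; lia.
split=> //; apply/eqP; rewrite eq_le; apply/andP; split; last first.
  by rewrite -vgeE // vgeD ?vge_refl // (vge_le _ kQ) //; lia.
rewrite leNgt; apply/negP => hkQ.
have : vge Q (Q h + 1) (h + k - k).
  by rewrite vgeB // vgeE //; lia.
by rewrite addrK vgeE //; lia.
Qed.

Lemma place_of_vge1 Q h a : a != 0 -> vge Q 1 (h - cst C a) -> h != 0 /\ Q h = 0.
Proof.
move=> a0 hQ; have := @place_dominant Q (cst C a) (h - cst C a).
rewrite place_cst add0r [cst C a + _]addrC subrK fmorph_eq0; exact.
Qed.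

Lemma place_eq (Q Q' : point C) : Q =1 Q' -> Q = Q'.
Proof.
case: Q Q' => v vP [w wP] /= /funext vw.
by rewrite -{w}vw in wP *; congr Point; apply: Prop_irrelevance.
Qed.

Definition ev x (p : {poly K}) : C := (map_poly (cst C) p).[x].

Lemma evD x p q : ev x (p + q) = ev x p + ev x q.
Proof. by rewrite /ev rmorphD hornerD. Qed.
Lemma evN x p : ev x (- p) = - ev x p.
Proof. by rewrite /ev rmorphN hornerN. Qed.
Lemma evB x p q : ev x (p - q) = ev x p - ev x q.
Proof. by rewrite evD evN. Qed.
Lemma evM x p q : ev x (p * q) = ev x p * ev x q.
Proof. by rewrite /ev rmorphM hornerM. Qed.
Lemma evC x a : ev x a%:P = cst C a.
Proof. by rewrite /ev map_polyC hornerC. Qed.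
Lemma evX x : ev x 'X = x.
Proof. by rewrite /ev map_polyX hornerX. Qed.
Lemma ev0 x : ev x 0 = 0.
Proof. by rewrite /ev rmorph0 horner0. Qed.
Lemma ev1 x : ev x 1 = 1.
Proof. by rewrite /ev rmorph1 hornerC. Qed.
Lemma evXn x p n : ev x (p ^+ n) = ev x p ^+ n.
Proof. by elim: n => [|n IH]; rewrite ?expr0 ?ev1 // !exprS evM IH. Qed.
Lemma evZ x a p : ev x (a *: p) = cst C a * ev x p.
Proof. by rewrite -mul_polyC evM evC. Qed.
Lemma evXsubC x b : ev x ('X - b%:P) = x - cst C b.
Proof. by rewrite evB evX evC. Qed.
Lemma ev_sum x (I : Type) (r : seq I) (P : pred I) (F : I -> {poly K}) :
  ev x (\sum_(i <- r | P i) F i) = \sum_(i <- r | P i) ev x (F i).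
Proof. by apply: (big_morph (ev x)); [apply: evD | apply: ev0]. Qed.
Lemma ev_prod x (I : Type) (r : seq I) (P : pred I) (F : I -> {poly K}) :
  ev x (\prod_(i <- r | P i) F i) = \prod_(i <- r | P i) ev x (F i).
Proof. by apply: (big_morph (ev x)); [apply: evM | apply: ev1]. Qed.
Lemma ev_comp x p q : ev x (p \Po q) = ev (ev x q) p.
Proof. by rewrite /ev map_comp_poly horner_comp. Qed.

Lemma vge_ev Q x p : vge Q 0 x -> vge Q 0 (ev x p).
Proof.
move=> xQ; elim/poly_ind: p => [|p c IH]; first by rewrite ev0 vge0.
by rewrite evD evM evX evC vgeD ?vge_cst // -[0]addr0 vgeM.
Qed.

Lemma vge1_vge0 Q x b : vge Q 1 (x - cst C b) -> vge Q 0 x.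
Proof. by move=> xb; rewrite -(subrK (cst C b) x) vgeD ?vge_cst // (vge_le _ xb). Qed.

Lemma vge_ev_sub Q x b p : vge Q 1 (x - cst C b) -> vge Q 1 (ev x p - cst C p.[b]).
Proof.
move=> xb; have : root (p - p.[b]%:P) b by rewrite /root !hornerE subrr.
case/factor_theorem => r pr.
rewrite -(evC x p.[b]) -evB pr evM evXsubC -[1]add0r vgeM //.
exact/vge_ev/(vge1_vge0 xb).
Qed.

(* At a pole of x the leading monomial of p dominates. *)
Lemma place_ev_pole Q x p : Q x < 0 -> p != 0 ->
  ev x p != 0 /\ Q (ev x p) = Q x *+ (size p).-1.
Proof.
move=> xQ; have x0 : x != 0 by apply: contraTneq xQ => ->; rewrite place0.
elim/poly_ind: p => [|p c IH]; first by rewrite eqxx.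
move=> pc0; have [p0|p0] := eqVneq p 0.
  move: pc0; rewrite p0 mul0r add0r polyC_eq0 => c0.
  by rewrite evC fmorph_eq0 size_polyC c0 place_cst.
have [evp Qp] := IH p0.
rewrite evD evM evX evC size_MXaddC (negbTE p0) /=.
have -> : Q x *+ size p = Q (ev x p * x).
  rewrite placeM // Qp -[in LHS](prednK (n:=size p)) ?lt0n ?size_poly_eq0 //.
  by rewrite mulrS addrC.
apply: place_dominant; first by rewrite mulf_neq0.
apply: vge_le (vge_cst Q c).
rewrite placeM // Qp; have : Q x *+ (size p).-1 <= 0 by rewrite mulrn_wle0 // ltW.
lia.
Qed.

(** [p] splits over [K] and every [h - c] has nonnegative value at [Q], so a product of positive
    value has a factor of positive value. *)
Lemma root_near Q h p : p != 0 -> vge Q 0 h -> vge Q 1 (ev h p) ->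
  exists c, vge Q 1 (h - cst C c).
Proof.
move=> p0 hQ; have [r pr] := closed_field_poly_normal p.
rewrite pr evZ ev_prod.
have lc0 : lead_coef p != 0 by rewrite lead_coef_eq0.
move=> H; have {H} : vge Q 1 (\prod_(z <- r) ev h ('X - z%:P)).
  by have := vgeM (vge_cst Q (lead_coef p)^-1) H; rewrite add0r mulrA -rmorphM mulVf // rmorph1 mul1r.
elim: r {pr} => [|c r IH]; first by rewrite big_nil vgeE ?oner_eq0 // place1.
rewrite big_cons evXsubC => H.
have [hc|hc] := boolP (vge Q 1 (h - cst C c)); first by exists c.
apply: IH; set w := \prod_(j <- r) _ in H *.
have [->|w0] := eqVneq w 0; first exact: vge0.
have hc0 : h - cst C c != 0 by apply: contraNneq hc => ->; apply: vge0.
move: H hc; rewrite !vgeE ?mulf_neq0 // placeM //.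
have : vge Q 0 (h - cst C c) by rewrite vgeB ?vge_cst.
by rewrite vgeE //; lia.
Qed.

Lemma ratfun_ev x p : ratfun_in (cst C) x (ev x p).
Proof.
exists p, 1; rewrite rmorph1 hornerC oner_eq0 divr1; by split.
Qed.

Lemma ratfunD x h k : ratfun_in (cst C) x h -> ratfun_in (cst C) x k ->
  ratfun_in (cst C) x (h + k).
Proof.
move=> [p [q [q0 ->]]] [p' [q' [q'0 ->]]].
exists (p * q' + p' * q), (q * q'); rewrite !rmorphD !rmorphM !hornerD !hornerM mulf_neq0 //.
by split=> //; rewrite addf_div.
Qed.

Lemma ratfunM x h k : ratfun_in (cst C) x h -> ratfun_in (cst C) x k ->
  ratfun_in (cst C) x (h * k).
Proof.
move=> [p [q [q0 ->]]] [p' [q' [q'0 ->]]].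
exists (p * p'), (q * q'); rewrite !rmorphM !hornerM mulf_neq0 //.
by split=> //; rewrite mulf_div.
Qed.

Lemma ratfunV x h : ratfun_in (cst C) x h -> ratfun_in (cst C) x h^-1.
Proof.
move=> [p [q [q0 ->]]].
have [p0|p0] := eqVneq (map_poly (cst C) p).[x] 0.
  by rewrite p0 mul0r invr0 -(ev0 x); apply: ratfun_ev.
by exists q, p; rewrite invf_div.
Qed.

Lemma ratfun_trans x z h : ratfun_in (cst C) z x ->
  ratfun_in (cst C) x h -> ratfun_in (cst C) z h.
Proof.
move=> xz; have evz p : ratfun_in (cst C) z (ev x p).
  elim/poly_ind: p => [|p c IH]; first by rewrite ev0 -(ev0 z); apply: ratfun_ev.
  rewrite evD evM evX evC; apply: ratfunD; first exact: ratfunM.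
  by rewrite -(evC z); apply: ratfun_ev.
by move=> [p [q [q0 ->]]]; exact: (ratfunM (evz p) (ratfunV (evz q))).
Qed.

End Valuation.

(** * The model y^2 = f(x) and its place at infinity *)

Section Model.
Local Open Scope ring_scope.

Definition squarefree (K : closedFieldType) (f : {poly K}) : Prop :=
  forall b, ~~ (('X - b%:P) ^+ 2 %| f).

Definition evy (K : closedFieldType) (C : curve K) (x y : C) A B : C :=
  ev x A + ev x B * y.

(* C is the curve y^2 = f(x), with deg f = 2m+1 and P its point at infinity. *)
Record is_model (K : closedFieldType) (C : curve K) (P : point C)
    (x y : C) (f : {poly K}) (m : nat) : Prop := IsModel {
  model_pole : P x < 0;
  model_eq : y ^+ 2 = ev x f;
  model_size : size f = (2 * m).+2;
  model_gen : forall h, exists A B d,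
    d != 0 /\ h * ev x d = evy x y A B }.

Variables (K : closedFieldType) (C : curve K) (P : point C).
Variables (x y : C) (f : {poly K}) (m : nat).
Implicit Types (Q : point C) (A B d p : {poly K}) (b c : K).
Hypothesis M : is_model P x y f m.

Local Notation ey := (evy x y).

Lemma model_f0 : f != 0.
Proof. by rewrite -size_poly_eq0 (model_size M). Qed.

Lemma model_ev_neq0 p : p != 0 -> ev x p != 0.
Proof. by move=> p0; have [] := place_ev_pole (model_pole M) p0. Qed.

Lemma model_y0 : y != 0.
Proof. by rewrite -sqrf_eq0 (model_eq M) model_ev_neq0 ?model_f0. Qed.

Lemma model_gen_div h : exists A B d, d != 0 /\ h = ey A B / ev x d.
Proof.
have [A [B [d [d0 hd]]]] := model_gen M h; exists A, B, d; split=> //.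
by rewrite -hd mulfK ?model_ev_neq0.
Qed.

Lemma evyD A B A' B' : ey A B + ey A' B' = ey (A + A') (B + B').
Proof. by rewrite /evy !evD; ring. Qed.

Lemma evyN A B : - ey A B = ey (- A) (- B).
Proof. by rewrite /evy !evN; ring. Qed.

Lemma evyM A B A' B' :
  ey A B * ey A' B' = ey (A * A' + B * B' * f) (A * B' + A' * B).
Proof. by rewrite /evy !(evD, evM) -(model_eq M); ring. Qed.

Lemma evy_ev A : ey A 0 = ev x A.
Proof. by rewrite /evy ev0 mul0r addr0. Qed.

Lemma evy_0 B : ey 0 B = ev x B * y.
Proof. by rewrite /evy ev0 add0r. Qed.

(** The order of the pole of A(x) + B(x) y at infinity, where x and y have poles of orders 2 and 2m
    + 1: the parities differ, so the two terms never cancel. For A = B = 0 the value 0 is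
    meaningless. *)
Definition pole_order (A B : {poly K}) : nat :=
  if B == 0 then (2 * (size A).-1)%N else
  if A == 0 then (2 * (size B).-1 + (2 * m).+1)%N else
  maxn (2 * (size A).-1) (2 * (size B).-1 + (2 * m).+1).

(** y^2 = f(x) gives 2 Q(y) = (2m + 1) Q(x), so both are multiples of u = Q(y) - m Q(x). The values
    of A(x) and B(x) y, if these are nonzero, are an even and an odd multiple of u, and the dominant
    term decides. *)
Lemma place_pole_evy Q : Q x < 0 -> exists2 u : int, u < 0 &
  [/\ Q x = u *+ 2, Q y = u *+ (2 * m).+1 &
      forall A B, ((A != 0) || (B != 0)) ->
        ey A B != 0 /\ Q (ey A B) = u *+ pole_order A B].
Proof.
move=> Qx; have Qy : Q y *+ 2 = Q x *+ (2 * m).+1.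
  rewrite -placeX (model_eq M); have [_ ->] := place_ev_pole Qx model_f0.
  by rewrite (model_size M).
pose u := Q y - Q x *+ m.
have xu : Q x = u *+ 2.
  by rewrite /u mulrnBl Qy -mulrnA mulrS mulnC addrK.
have yu : Q y = u *+ (2 * m).+1.
  by rewrite mulrS mulrnA -xu /u subrK.
exists u; first lia.
split=> // A B.
have QA : A != 0 -> ev x A != 0 /\ Q (ev x A) = u *+ (2 * (size A).-1).
  by move=> /(place_ev_pole Qx)[? ->]; rewrite xu -mulrnA.
have QB : B != 0 -> ev x B * y != 0 /\
    Q (ev x B * y) = u *+ (2 * (size B).-1 + (2 * m).+1).
  move=> /(place_ev_pole Qx)[Bx QBx]; rewrite mulf_neq0 ?model_y0 //; split=> //.
  by rewrite placeM ?model_y0 // QBx yu xu mulrnDr -!mulrnA.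
rewrite /pole_order; have [->|B0] /= := eqVneq B 0.
  by rewrite evy_ev orbF => /QA.
have [-> _|A0 _] := eqVneq A 0; first by rewrite evy_0; apply: QB.
have [{}Ax {}QA] := QA A0; have [By {}QB] := QB B0.
have u0 : u < 0 by lia.
rewrite /evy; case: (leqP (2 * (size B).-1 + (2 * m).+1) (2 * (size A).-1)) => le.
  rewrite -QA; apply: place_dominant => //.
  by rewrite vgeE // QA QB !pmulrn; nia.
rewrite addrC -QB; apply: place_dominant => //.
by rewrite vgeE // QA QB !pmulrn; nia.
Qed.

Lemma evy_eq0 A B : ey A B = 0 -> A = 0 /\ B = 0.
Proof.
have [u _ [_ _ H]] := place_pole_evy (model_pole M).
have [->|A0] := eqVneq A 0; have [->|B0] := eqVneq B 0 => // e0.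
- by have [] := H 0 B; rewrite ?B0 ?orbT // e0 eqxx.
- by have [] := H A 0; rewrite ?A0 // e0 eqxx.
- by have [] := H A B; rewrite ?A0 // e0 eqxx.
Qed.

Lemma evy_inj A B A' B' : ey A B = ey A' B' -> A = A' /\ B = B'.
Proof.
move/eqP; rewrite -subr_eq0 evyN evyD => /eqP/evy_eq0[/eqP + /eqP].
by rewrite !subr_eq0 => /eqP-> /eqP->.
Qed.

(** All values at [Q] are multiples of u, the function field being K(x) + K(x) y; a uniformizer has
    value 1, so u = -1. *)
Lemma place_pole_normalized Q : Q x < 0 ->
  [/\ Q x = - 2, Q y = - (2 * m).+1%:Z &
    forall A B, ((A != 0) || (B != 0)) ->
        ey A B != 0 /\ Q (ey A B) = - (pole_order A B)%:Z].
Proof.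
move=> /place_pole_evy[u u0 [Qx Qy H]].
suff u1 : u = -1.
  by split; [rewrite Qx u1 | rewrite Qy u1 mulNrn natz
    | move=> A B /H[? ->]; rewrite u1 mulNrn natz].
have [t t0 Qt] := place_unif Q.
have [A [B [d [d0 td]]]] := model_gen M t.
have [dx0 Qd] := H d 0 (introT orP (or_introl d0)); rewrite evy_ev in dx0 Qd.
have AB : (A != 0) || (B != 0).
  rewrite -negb_and; apply/negP => /andP[/eqP A0 /eqP B0].
  by move/eqP: td; rewrite A0 B0 evy_ev ev0 mulf_eq0 (negbTE t0) (negbTE dx0).
have [_ QAB] := H A B AB.
move: QAB; rewrite -td placeM // Qt Qd !pmulrn !mulrzz.
move: (pole_order A B) (pole_order d 0) => i j ij.
pose k : int := i%:Z - j%:Z.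
have uk : u * k = 1 by rewrite mulrBr -ij addrK.
have k0 : k < 0 by nia.
nia.
Qed.

(** Values at a pole of [x] are differences of pole orders computed from A, B and d alone, hence the
    same at every such place. *)
Lemma place_pole_eq Q : Q x < 0 -> Q = P.
Proof.
move=> Qx; apply: place_eq => h.
have [_ _ HQ] := place_pole_normalized Qx.
have [_ _ HP] := place_pole_normalized (model_pole M).
have [->|h0] := eqVneq h 0; first by rewrite !place0.
have [A [B [d [d0 hd]]]] := model_gen_div h.
have dx0 := model_ev_neq0 d0.
have AB : (A != 0) || (B != 0).
  rewrite -negb_and; apply/negP => /andP[/eqP A0 /eqP B0].
  by move: h0; rewrite hd A0 B0 evy_ev ev0 mul0r eqxx.
have [e0 Qe] := HQ A B AB; have [_ Pe] := HP A B AB.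
have [_ Qd] := HQ d 0 (introT orP (or_introl d0)).
have [_ Pd] := HP d 0 (introT orP (or_introl d0)).
rewrite !evy_ev in Qd Pd.
by rewrite hd !placeM ?invr_eq0 // !placeV Qe Pe Qd Pd.
Qed.

Lemma place_finite Q : Q != P -> vge Q 0 x.
Proof.
apply: contraNT; rewrite /vge negb_or -ltNge => /andP[_ /place_pole_eq->].
by rewrite eqxx.
Qed.

End Model.

(** * Places above a point of the affine line *)

Section LocalRing.
Local Open Scope ring_scope.
Variables (K : closedFieldType) (C : curve K) (P : point C).
Variables (x y : C) (f : {poly K}) (m : nat).
Hypotheses (M : is_model P x y f m) (sqf : squarefree f) (two : 2%:R != 0 :> K).
Implicit Types (Q : point C) (A B d p : {poly K}).
Variables (b c : K).
Hypothesis bc : c ^+ 2 = f.[b].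

Local Notation ey := (evy x y).

(* a is a regular function A(x) + B(x) y taking the value k at (b, c). *)
Definition regular_value (a : C) (k : K) : Prop :=
  exists A B, a = ey A B /\ k = A.[b] + B.[b] * c.

Local Notation rv := regular_value.

Lemma rv_uniq a k k' : rv a k -> rv a k' -> k = k'.
Proof. by move=> [A [B [-> ->]]] [A' [B' [/(evy_inj M)[-> ->] ->]]]. Qed.

Lemma rvD a k a' k' : rv a k -> rv a' k' -> rv (a + a') (k + k').
Proof.
move=> [A [B [-> ->]]] [A' [B' [-> ->]]]; exists (A + A'), (B + B').
by split; [rewrite evyD | rewrite !hornerD; ring].
Qed.

Lemma rvM a k a' k' : rv a k -> rv a' k' -> rv (a * a') (k * k').
Proof.
move=> [A [B [-> ->]]] [A' [B' [-> ->]]].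
exists (A * A' + B * B' * f), (A * B' + A' * B); split; first by rewrite (evyM M).
by rewrite !(hornerD, hornerM) -bc; ring.
Qed.

Lemma rv_ev p : rv (ev x p) p.[b].
Proof. by exists p, 0; rewrite evy_ev horner0 mul0r addr0. Qed.

Lemma rv_evy A B : rv (ey A B) (A.[b] + B.[b] * c).
Proof. by exists A, B. Qed.

Lemma rv_y : rv y c.
Proof. by exists 0, 1; rewrite evy_0 ev1 mul1r !hornerE. Qed.

Lemma rvX a k n : rv a k -> rv (a ^+ n) (k ^+ n).
Proof.
move=> ak; elim: n => [|n IH]; last by rewrite !exprS; apply: rvM.
by rewrite !expr0; have := rv_ev 1; rewrite ev1 hornerC.
Qed.

Lemma rv_neq0 a k : rv a k -> k != 0 -> a != 0.
Proof.
move=> ak; apply: contraNneq => a0; apply/eqP/(rv_uniq ak).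
by rewrite a0; have := rv_ev 0; rewrite ev0 horner0.
Qed.

Definition local_unit (u : C) : Prop := exists a k a' k',
  [/\ rv a k, rv a' k', k != 0, k' != 0 & u = a / a'].

Local Notation lu := local_unit.

Lemma luM u u' : lu u -> lu u' -> lu (u * u').
Proof.
move=> [a [k [b1 [l [ak bl k0 l0 ->]]]]] [a' [k' [b' [l' [ak' bl' k'0 l'0 ->]]]]].
exists (a * a'), (k * k'), (b1 * b'), (l * l').
by split; rewrite ?mulf_neq0 ?mulf_div //; apply: rvM.
Qed.

Lemma luV u : lu u -> lu u^-1.
Proof.
by move=> [a [k [b1 [l [ak bl k0 l0 ->]]]]]; exists b1, l, a, k; rewrite invf_div.
Qed.

Lemma lu_rv a k : rv a k -> k != 0 -> lu a.
Proof.
move=> ak k0; exists a, k, 1, 1; rewrite divr1 oner_eq0; split=> //.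
by have := rv_ev 1; rewrite ev1 hornerC.
Qed.

Lemma lu_neq0 u : lu u -> u != 0.
Proof.
move=> [a [k [b1 [l [ak bl k0 l0 ->]]]]].
by rewrite mulf_neq0 ?invr_eq0 ?(rv_neq0 ak) ?(rv_neq0 bl).
Qed.

(** At a branch point, where c = 0, [x - b] vanishes to order 2 and [y] to order 1; elsewhere
    [x - b] vanishes to order 1. *)
Definition uniformizer : C := if f.[b] == 0 then y else x - cst C b.

Local Notation t := uniformizer.

Lemma rv_xb : rv (x - cst C b) 0.
Proof. by rewrite -evXsubC -(subrr b); have := rv_ev ('X - b%:P); rewrite !hornerE. Qed.

Lemma c0E : (c == 0) = (f.[b] == 0).
Proof. by rewrite -bc sqrf_eq0. Qed.

Lemma rv_t : rv t 0.
Proof.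
rewrite /t -c0E; case: eqP => [c0|_]; last exact: rv_xb.
by rewrite -[in X in rv _ X]c0; apply: rv_y.
Qed.

Lemma xb_neq0 : x - cst C b != 0.
Proof. by rewrite -evXsubC (model_ev_neq0 M) ?polyXsubC_eq0. Qed.

Lemma t_neq0 : t != 0.
Proof. by rewrite /t; case: ifP => _; [apply: model_y0 M | apply: xb_neq0]. Qed.

Lemma f_simple_root : f.[b] = 0 ->
  exists2 f1, f1.[b] != 0 & f = f1 * ('X - b%:P).
Proof.
move=> /rootP/factor_theorem[f1 f1E]; exists f1 => //.
apply: contraNneq (sqf b) => /rootP/factor_theorem[f2 f2E].
by rewrite f1E f2E -mulrA dvdp_mull.
Qed.

Lemma ramified_xb f1 : f1.[b] != 0 -> f = f1 * ('X - b%:P) ->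
  x - cst C b = y ^+ 2 / ev x f1.
Proof.
move=> f1b fE; rewrite (model_eq M) fE evM evXsubC mulrAC mulfV ?mul1r //.
exact: rv_neq0 (rv_ev f1) f1b.
Qed.

(** This is what makes the local ring at (b, c) a discrete valuation ring; [n] becomes the order of
    [h] there. *)
Definition has_decomposition (h : C) : Prop := exists (n : int) u, lu u /\ h = t ^ n * u.

Local Notation dec := has_decomposition.

Lemma decM h k : dec h -> dec k -> dec (h * k).
Proof.
move=> [n [u [uU ->]]] [n' [u' [uU' ->]]]; exists (n + n'), (u * u').
by split; [apply: luM | rewrite expfzDr ?t_neq0 // mulrACA].
Qed.

Lemma decV h : dec h -> dec h^-1.
Proof.
move=> [n [u [uU ->]]]; exists (- n), u^-1; split; first exact: luV.
by rewrite invfM invr_expz.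
Qed.

Lemma dec_lu u : lu u -> dec u.
Proof. by move=> uU; exists 0, u; rewrite expr0z mul1r. Qed.

Lemma lu1 : lu 1.
Proof. by apply: (@lu_rv _ 1); rewrite ?oner_eq0 //; have := rv_ev 1; rewrite ev1 hornerC. Qed.

Lemma dec_t : dec t.
Proof. by exists 1, 1; rewrite expr1z mulr1; split=> //; apply: lu1. Qed.

Lemma dec_xb : dec (x - cst C b).
Proof.
have [fb0|fb0] := eqVneq f.[b] 0; last first.
  by have := dec_t; rewrite /t (negbTE fb0).
have [f1 f1b fE] := f_simple_root fb0.
rewrite (ramified_xb f1b fE); apply: decM; last first.
  exact/decV/dec_lu/(lu_rv (rv_ev f1)).
by have := dec_t; rewrite /t fb0 eqxx expr2 => ty; apply: decM.
Qed.

Lemma dec_ev p : p != 0 -> dec (ev x p).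
Proof.
move=> p0; have [n [q]] := multiplicity_XsubC p b; rewrite p0 /= => qb ->.
rewrite evM; apply: decM; first exact/dec_lu/(lu_rv (rv_ev q)).
rewrite evXn evXsubC; elim: n => [|n IH]; first by rewrite expr0; apply/dec_lu/lu1.
by rewrite exprS; apply: decM => //; apply: dec_xb.
Qed.

(** A function not vanishing at (b, c) is a unit. If A and B both vanish at b, a factor x - b comes
    out and the sizes drop. If c = 0 and only A vanishes, y comes out because x - b = y^2 / f1.
    Otherwise the conjugate A - B y does not vanish at (b, c), as 2 is nonzero, and A + B y is the
    norm A^2 - B^2 f divided by it. *)
Lemma dec_evy A B : ey A B != 0 -> dec (ey A B).
Proof.
have [n] := ubnP (size A + size B); elim: n A B => // n IH A B AB e0.
have [v0|v0] := eqVneq (A.[b] + B.[b] * c) 0; last exact/dec_lu/(lu_rv (rv_evy A B)).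
have [Bb|Bb] := eqVneq B.[b] 0.
  have Ab : A.[b] = 0 by rewrite Bb mul0r addr0 in v0.
  have [A1 A1E] := factor_theorem _ _ (introT rootP Ab).
  have [B1 B1E] := factor_theorem _ _ (introT rootP Bb).
  have e1 : ey A B = ey A1 B1 * (x - cst C b).
    by rewrite /evy A1E B1E !evM evXsubC; ring.
  rewrite e1 in e0 *; have {}e0 : ey A1 B1 != 0 by apply: contraNneq e0 => ->; rewrite mul0r.
  apply: decM; last exact: dec_xb; apply: IH => //.
  have sz p : p != 0 -> size (p * ('X - b%:P)) = (size p).+1.
    by move=> p0; rewrite size_Mmonic ?monicXsubC // size_XsubC addn2.
  move: AB e0; rewrite A1E B1E.
  have [->|A10] := eqVneq A1 0; have [->|B10] := eqVneq B1 0;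
    rewrite ?mul0r ?sz // ?size_poly0; try lia.
  by rewrite evy_ev ev0 eqxx.
have [c0|c0] := eqVneq c 0.
  have Ab : A.[b] = 0 by rewrite c0 mulr0 addr0 in v0.
  have fb0 : f.[b] = 0 by apply/eqP; rewrite -c0E c0.
  have [A1 A1E] := factor_theorem _ _ (introT rootP Ab).
  have [f1 f1b fE] := f_simple_root fb0.
  have -> : ey A B = y * (ey (B * f1) A1 / ev x f1).
    have f1x : ev x f1 != 0 := rv_neq0 (rv_ev f1) f1b.
    by rewrite /evy A1E !evM evXsubC (ramified_xb f1b fE); field.
  apply: decM; first by have := dec_t; rewrite /t fb0 eqxx.
  apply: dec_lu; apply: luM; last exact/luV/(lu_rv (rv_ev f1)).
  by apply: lu_rv (rv_evy _ _) _; rewrite c0 mulr0 addr0 hornerM mulf_neq0.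
have cj0 : A.[b] + (- B).[b] * c != 0.
  rewrite hornerN mulNr; apply/negP => /eqP cj; move: Bb c0 two.
  have : 2%:R * (B.[b] * c) = 0 by rewrite -[RHS](subrr 0) -{1}v0 -cj; ring.
  by move/eqP; rewrite !mulf_eq0 => /orP[->//|/orP[->|->]].
have cjU : lu (ey A (- B)) := lu_rv (rv_evy _ _) cj0.
have NE : ey A B * ey A (- B) = ev x (A ^+ 2 - B ^+ 2 * f).
  by rewrite (evyM M) -(evy_ev x y); congr (evy x y _ _); ring.
have -> : ey A B = ev x (A ^+ 2 - B ^+ 2 * f) * (ey A (- B))^-1.
  by rewrite -NE mulfK // lu_neq0.
apply: decM; last exact/decV/dec_lu.
apply: dec_ev; apply/eqP => N0; have := mulf_neq0 e0 (lu_neq0 cjU).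
by rewrite NE N0 ev0 eqxx.
Qed.

Lemma dec_all h : h != 0 -> dec h.
Proof.
move=> h0; have [A [B [d [d0 hd]]]] := model_gen_div M h.
rewrite hd; apply: decM; last exact/decV/dec_ev.
by apply: dec_evy; apply: contraNneq h0 => e0; rewrite hd e0 mul0r.
Qed.

Lemma lu_t_pos n u u' : lu u -> lu u' -> t ^+ n.+1 * u != u'.
Proof.
move=> [a [k [b1 [l [ak bl k0 l0 ->]]]]] [a' [k' [b' [l' [ak' bl' k'0 l'0 ->]]]]].
have b10 := rv_neq0 bl l0; have b'0 := rv_neq0 bl' l'0.
apply/eqP => e; have e' : t ^+ n.+1 * (a * b') = a' * b1.
  by rewrite -[a](divfK b10) -[a' in RHS](divfK b'0) -e; ring.
have := rvM (rvX n.+1 rv_t) (rvM ak bl'); rewrite e' expr0n mul0r.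
move/(rv_uniq (rvM ak' bl))/eqP.
by rewrite mulf_eq0 (negbTE k'0) (negbTE l0).
Qed.

Lemma dec_uniq n n' u u' : lu u -> lu u' -> t ^ n * u = t ^ n' * u' -> n = n'.
Proof.
wlog nn' : n n' u u' / n' <= n.
  move=> H uU uU' e; have [le|/ltW le] := leP n' n; first exact: (H n n' u u').
  by apply/esym/(H n' n u' u).
move=> uU uU' e; have [j nj] : exists j : nat, n = n' + j%:Z.
  by exists `|n - n'|%N; lia.
have e' : t ^+ j * u = u'.
  have tn0 : t ^ n' != 0 by rewrite expfz_neq0 ?t_neq0.
  apply: (mulfI tn0); rewrite mulrA -e nj expfzDr ?t_neq0 //.
case: j e' nj => [|j] e' ->; first by rewrite addr0.
by have := lu_t_pos j uU uU'; rewrite e' eqxx.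
Qed.

(** The ultrametric inequality, once the smaller power of [t] is factored out. For n < 0,
    multiplying by t^(-n) and clearing denominators would equate a regular function vanishing at (b,
    c) with one that does not vanish. *)
Lemma dec_add_ge0 j n u u' u'' : lu u -> lu u' -> lu u'' ->
  u + t ^+ j * u' = t ^ n * u'' -> 0 <= n.
Proof.
move=> [a [k [b1 [l [ak bl k0 l0 ->]]]]] [a' [k' [b' [l' [ak' bl' k'0 l'0 ->]]]]].
move=> uU''; have b10 := rv_neq0 bl l0; have b'0 := rv_neq0 bl' l'0.
case: n => // n; rewrite NegzE => e; exfalso.
move: uU'' e => [a'' [k'' [b'' [l'' [ak'' bl'' k''0 l''0 ->]]]]].
have b''0 := rv_neq0 bl'' l''0.
have tn0 : t ^+ n.+1 != 0 by rewrite expf_neq0 ?t_neq0.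
rewrite -exprnN => e.
have e' : t ^+ n.+1 * ((a * b' + t ^+ j * (a' * b1)) * b'') = a'' * (b1 * b').
  have -> : a * b' + t ^+ j * (a' * b1) = (a / b1 + t ^+ j * (a' / b')) * (b1 * b').
    by field; apply/andP.
  by rewrite e; field; rewrite b''0.
have := rvM (rvX n.+1 rv_t) (rvM (rvD (rvM ak bl') (rvM (rvX j rv_t) (rvM ak' bl))) bl'').
rewrite e' expr0n mul0r => /(rv_uniq (rvM ak'' (rvM bl bl')))/eqP.
by rewrite !mulf_eq0 (negbTE k''0) (negbTE l0) (negbTE l'0).
Qed.

Definition local_ord (h : C) : int :=
  match pselect (h != 0) with
  | left h0 => projT1 (cid (dec_all h0))
  | right _ => 0
  end.

Lemma local_ordE n u : lu u -> local_ord (t ^ n * u) = n.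
Proof.
move=> uU; rewrite /local_ord; case: pselect => [h0|]; last first.
  by rewrite mulf_neq0 ?expfz_neq0 ?t_neq0 ?lu_neq0.
case: cid => n' /= [u' [uU' e]].
exact: dec_uniq uU' uU (esym e).
Qed.

Lemma local_ord_place : is_place (cst C) local_ord.
Proof.
split.
- by rewrite /local_ord; case: pselect => // h0; case/eqP: (h0).
- move=> a; have [->|a0] := eqVneq a 0.
    by rewrite rmorph0 /local_ord; case: pselect => // h0; case/eqP: (h0).
  rewrite -[cst C a]mul1r -(expr0z t); apply: local_ordE.
  by rewrite -(evC x); apply: (lu_rv (rv_ev _)); rewrite hornerC.
- move=> h k; rewrite !inE => /dec_all[n [u [uU ->]]] /dec_all[n' [u' [uU' ->]]].
  by rewrite mulrACA -expfzDr ?t_neq0 // !local_ordE //; apply: luM.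
- move=> h k /dec_all[n [u [uU ->]]] /dec_all[n' [u' [uU' ->]]].
  wlog nn' : n n' u u' uU uU' / n <= n'.
    move=> H; have [le|/ltW le] := leP n n'; first exact: H.
    by rewrite addrC minC; apply: H.
  have [j nj] : exists j : nat, n' = n + j%:Z by exists `|n' - n|%N; lia.
  have -> : t ^ n * u + t ^ n' * u' = t ^ n * (u + t ^+ j * u').
    by rewrite nj expfzDr ?t_neq0 // mulrDr mulrA.
  move=> s0; have : u + t ^+ j * u' != 0 by apply: contraNneq s0 => ->; rewrite mulr0.
  move=> /dec_all[n'' [u'' [uU'' e]]]; have n''0 := dec_add_ge0 uU uU' uU'' e.
  rewrite e mulrA -expfzDr ?t_neq0 // !local_ordE //.
  by rewrite ge_min lerDl n''0.
- by exists t; [apply: t_neq0 | rewrite -[t in local_ord t]mulr1 -(expr1z t) local_ordE //; apply: lu1].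
Qed.

Lemma rv_vge Q a k : vge Q 1 (x - cst C b) -> vge Q 1 (y - cst C c) ->
  rv a k -> vge Q 1 (a - cst C k).
Proof.
move=> Qx Qy [A [B [-> ->]]].
have -> : ey A B - cst C (A.[b] + B.[b] * c) =
   (ev x A - cst C A.[b]) + ((ev x B - cst C B.[b]) * y + cst C B.[b] * (y - cst C c)).
  by rewrite /evy rmorphD rmorphM; ring.
rewrite vgeD ?vge_ev_sub // vgeD //; last by rewrite -[1]add0r vgeM ?vge_cst.
by rewrite -[1]addr0 vgeM ?vge_ev_sub //; apply: vge1_vge0 Qy.
Qed.

(** [Q] is the point (b, c) of the affine curve. *)
Definition centered Q : Prop := vge Q 1 (x - cst C b) /\ vge Q 1 (y - cst C c).

Lemma centered_lu Q u : centered Q -> lu u -> Q u = 0.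
Proof.
move=> [Qx Qy] [a [k [a' [k' [ak ak' k0 k'0 ->]]]]].
have [a0 Qa] := place_of_vge1 k0 (rv_vge Qx Qy ak).
have [a'0 Qa'] := place_of_vge1 k'0 (rv_vge Qx Qy ak').
by rewrite placeM ?invr_eq0 // placeV Qa Qa'.
Qed.

Lemma placeXz Q h (n : int) : Q (h ^ n) = Q h * n.
Proof.
case: n => n; first by rewrite -exprnP placeX -mulr_natr natz.
by rewrite NegzE -exprnN placeV placeX -mulr_natr natz mulrN.
Qed.

(** [Q] takes the value 0 on local units, so all its values are multiples of the positive integer
    [Q t]; the value 1 is among them. *)
Lemma centered_t Q : centered Q -> Q t = 1.
Proof.
move=> Qc; have [s s0 Qs] := place_unif Q.
have [n [u [uU sE]]] := dec_all s0.
move: Qs; rewrite sE placeM ?expfz_neq0 ?t_neq0 ?lu_neq0 // placeXz (centered_lu Qc uU) addr0.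
have : vge Q 1 (t - cst C 0) by case: Qc => Qx Qy; apply: (rv_vge Qx Qy rv_t).
rewrite rmorph0 subr0 vgeE ?t_neq0 // => Qt1 Qtn.
have n0 : 0 < n by nia.
nia.
Qed.

Lemma centered_uniq Q Q' : centered Q -> centered Q' -> Q = Q'.
Proof.
move=> Qc Qc'; apply: place_eq => h.
have [->|/dec_all[n [u [uU ->]]]] := eqVneq h 0; first by rewrite !place0.
rewrite !placeM ?expfz_neq0 ?t_neq0 ?lu_neq0 // !placeXz !centered_t //.
by rewrite !(centered_lu _ uU).
Qed.

Lemma centered_exists : exists Q, centered Q.
Proof.
exists (Point local_ord_place).
have H h : rv h 0 -> vge (Point local_ord_place) 1 h.
  move=> h0; rewrite /vge; case: eqP => //= /eqP/dec_all[n [u [uU hE]]].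
  rewrite hE local_ordE //; rewrite leNgt; apply/negP => n0.
  move: uU hE => [a [k [a' [k' [ak ak' k0 k'0 ->]]]]] hE.
  have [j nj] : exists j : nat, n = - j%:Z by exists `|n|%N; lia.
  have e : t ^+ j * (h * a') = a.
    rewrite hE nj -exprnN; have tj : t ^+ j != 0 by rewrite expf_neq0 ?t_neq0.
    by field; rewrite (rv_neq0 ak').
  have := rvM (rvX j rv_t) (rvM h0 ak'); rewrite e mul0r mulr0.
  by move/(rv_uniq ak)/eqP; rewrite (negbTE k0).
split; apply: H; first exact: rv_xb.
by have := rvD rv_y (rv_ev (- c%:P)); rewrite evN evC hornerN hornerC subrr.
Qed.

Lemma centered_xb Q : centered Q ->
  Q (x - cst C b) = if f.[b] == 0 then 2 else 1.
Proof.
move=> Qc; have := centered_t Qc; rewrite /t; case: eqP => // fb0 Qy.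
have [f1 f1b fE] := f_simple_root fb0.
have f1U := lu_rv (rv_ev f1) f1b.
rewrite (ramified_xb f1b fE) placeM ?invr_eq0 ?expf_neq0 ?(model_y0 M) ?lu_neq0 //.
by rewrite placeX Qy placeV (centered_lu Qc f1U) subr0.
Qed.

End LocalRing.

(** * Residues at a place, and functions regular on the affine curve *)

Section Residue.
Local Open Scope ring_scope.
Variables (K : closedFieldType) (C : curve K) (P : point C).
Variables (x y : C) (f : {poly K}) (m : nat).
Hypothesis M : is_model P x y f m.
Implicit Types (Q : point C) (A B d p : {poly K}) (a b c : K).

Local Notation ey := (evy x y).
Local Notation centered := (centered x y).

Lemma exists_sqrt a : exists r : K, r ^+ 2 = a.
Proof.
have : size ('X^2 - a%:P) != 1 by rewrite size_XnsubC.
case/closed_rootP=> r; rewrite /root !hornerE subr_eq0 => /eqP.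
by exists r.
Qed.

Lemma vge1_cst Q a : vge Q 1 (cst C a) -> a = 0.
Proof.
move=> aQ; apply/eqP; apply: contraTT aQ => a0.
by rewrite vgeE ?fmorph_eq0 // place_cst.
Qed.

Lemma norm_evy A B : ey A B * ey A (- B) = ev x (A ^+ 2 - B ^+ 2 * f).
Proof. by rewrite (evyM M) -(evy_ev x y); congr (evy x y _ _); ring. Qed.

Lemma quadratic_evy A B : (ey A B) ^+ 2 =
  2%:R * ev x A * ey A B - ev x (A ^+ 2 - B ^+ 2 * f).
Proof. by rewrite -norm_evy /evy evN; ring. Qed.

(* Otherwise Q would be trivial on K(x), over which C is algebraic. *)
Lemma finite_place_x Q : Q != P -> exists b, vge Q 1 (x - cst C b).
Proof.
move=> QP; have xQ := place_finite M QP; apply: contrapT => nb.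
have Q0 p : p != 0 -> Q (ev x p) = 0.
  move=> p0; have : vge Q 0 (ev x p) := vge_ev p xQ.
  have px0 := model_ev_neq0 M p0.
  rewrite vgeE // le_eqVlt => /orP[/eqP//|p1].
  by case: nb; apply: (root_near p0 xQ); rewrite vgeE //; lia.
have [t t0 Qt] := place_unif Q.
have [A [B [d [d0 td]]]] := model_gen M t.
have dx0 := model_ev_neq0 M d0.
have e0 : ey A B != 0 by rewrite -td mulf_neq0.
have Qe : vge Q 1 (ey A B) by rewrite -td vgeE ?mulf_neq0 // placeM // Q0 // Qt.
have N0 : A ^+ 2 - B ^+ 2 * f != 0.
  have : ey A (- B) != 0.
    apply: contraNneq e0 => /(evy_eq0 M)[-> /eqP]; rewrite oppr_eq0 => /eqP->.
    by rewrite evy_ev ev0.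
  move=> e0'; apply: contraTneq (mulf_neq0 e0 e0') => N0.
  by rewrite norm_evy N0 ev0 eqxx.
have : vge Q 1 (ev x (A ^+ 2 - B ^+ 2 * f)).
  have -> : ev x (A ^+ 2 - B ^+ 2 * f) =
     (ev x (2%:R *: A) - ey A B) * ey A B.
    by rewrite mulrBl -expr2 quadratic_evy evZ rmorph_nat; ring.
  rewrite -[1]add0r vgeM // vgeB //; first exact: vge_ev.
  exact: vge_le Qe.
by rewrite vgeE ?(model_ev_neq0 M) // Q0.
Qed.

Lemma place_y_value Q b : vge Q 1 (x - cst C b) ->
  exists2 c, c ^+ 2 = f.[b] & centered b c Q.
Proof.
move=> xb; have fb := vge_ev_sub f xb; rewrite -(model_eq M) in fb.
have yQ : vge Q 0 y.
  have : vge Q 0 (y ^+ 2) by rewrite (model_eq M); apply/vge_ev/(vge1_vge0 xb).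
  by rewrite !vgeE ?expf_neq0 ?(model_y0 M) // placeX; lia.
have X0 : 'X^2 - f.[b]%:P != 0 by rewrite -size_poly_eq0 size_XnsubC.
have [|c yc] := root_near X0 yQ; first by rewrite evB evC evXn evX.
exists c; last by split.
apply/eqP; rewrite -subr_eq0; apply/eqP/(@vge1_cst Q).
have -> : cst C (c ^+ 2 - f.[b]) =
   (y ^+ 2 - cst C f.[b]) - (y - cst C c) * (y + cst C c).
  by rewrite rmorphB rmorphXn; ring.
by rewrite vgeB // -[1]addr0 vgeM // vgeD ?vge_cst.
Qed.

Lemma finite_place_centered Q : Q != P ->
  exists b c, c ^+ 2 = f.[b] /\ centered b c Q.
Proof. by move=> /finite_place_x[b /place_y_value[c ? ?]]; exists b, c. Qed.

Lemma centered_neq b c Q : centered b c Q -> Q != P.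
Proof.
move=> [xb _]; apply: contraTneq (model_pole M) => <-.
have := vge1_vge0 xb; rewrite vgeE -?leNgt //.
by rewrite -(evX x) (model_ev_neq0 M) ?polyX_eq0.
Qed.

(** Where x = b, common factors x - b are cancelled until some polynomial is nonzero at b. At
    infinity, division by x^N with N the largest degree leaves the coefficients of degree N. *)
Lemma common_scaling Q p0 p1 p2 : p0 != 0 -> exists s k0 k1 k2,
  [/\ s != 0 :> C, ~~ [&& k0 == 0, k1 == 0 & k2 == 0],
      vge Q 1 (ev x p0 * s - cst C k0), vge Q 1 (ev x p1 * s - cst C k1) &
      vge Q 1 (ev x p2 * s - cst C k2)].
Proof.
have [-> p00|/finite_place_x[b xb]] := eqVneq Q P.
  have x0 : x != 0 by rewrite -(evX x) (model_ev_neq0 M) ?polyX_eq0.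
  have [N [sN N0]] : exists N : nat, [/\ forall p, p \in [:: p0; p1; p2] -> (size p <= N.+1)%N &
      ~~ [&& p0`_N == 0, p1`_N == 0 & p2`_N == 0]].
    have lc p N : (size p = N.+1) -> p`_N != 0.
      by move=> sp; have := lead_coef_eq0 p; rewrite lead_coefE sp /= => ->; rewrite -size_poly_eq0 sp.
    exists (maxn (size p0) (maxn (size p1) (size p2))).-1.
    rewrite -size_poly_gt0 in p00.
    split=> [p|]; first by rewrite !inE => /or3P[] /eqP->; lia.
    have [H|[H|H]] : (size p0 = (maxn (size p0) (maxn (size p1) (size p2))).-1.+1) \/
      (size p1 = (maxn (size p0) (maxn (size p1) (size p2))).-1.+1) \/
      (size p2 = (maxn (size p0) (maxn (size p1) (size p2))).-1.+1) by lia.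
    - by rewrite (negbTE (lc _ _ H)).
    - by rewrite (negbTE (lc _ _ H)) /= andbF.
    - by rewrite (negbTE (lc _ _ H)) /= !andbF.
  exists (x ^- N), p0`_N, p1`_N, p2`_N.
  have H p : p \in [:: p0; p1; p2] -> vge P 1 (ev x p * x ^- N - cst C p`_N).
    move=> /sN sp; have xN0 : x ^+ N != 0 by rewrite expf_neq0.
    have -> : ev x p * x ^- N - cst C p`_N = ev x (p - p`_N *: 'X^N) * x ^- N.
      by rewrite evB evZ evXn evX mulrBl mulfK.
    have [->|p'0] := eqVneq (p - p`_N *: 'X^N) 0; first by rewrite ev0 mul0r vge0.
    have [px0 Pp] := place_ev_pole (model_pole M) p'0.
    rewrite vgeE ?mulf_neq0 ?invr_eq0 // placeM ?invr_eq0 // Pp placeV placeX.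
    have sp' : (size (p - p`_N *: 'X^N)%R <= N)%N.
      apply/leq_sizeP => j; rewrite leq_eqVlt coefB coefZ coefXn => /orP[/eqP<-|Nj].
        by rewrite eqxx mulr1 subrr.
      by rewrite gtn_eqF // mulr0 subr0 nth_default // (leq_trans sp).
    move: p'0; rewrite -size_poly_gt0 => s0.
    have [-> _ _] := place_pole_normalized M (model_pole M).
    move: sp' s0; move: (size _) => k; rewrite !pmulrn !mulrzz.
    lia.
  by split; rewrite ?invr_eq0 ?expf_neq0 // H // !inE eqxx ?orbT.
have [n] := ubnP (size p0); elim: n p0 p1 p2 => // n IH p0 p1 p2 sp p00.
have [/and3P[r0 r1 r2]|r] := boolP [&& p0.[b] == 0, p1.[b] == 0 & p2.[b] == 0]; last first.
  exists 1, p0.[b], p1.[b], p2.[b]; rewrite oner_eq0 !mulr1.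
  by split=> //; apply: vge_ev_sub.
have [q0 q0E] := factor_theorem _ _ r0.
have [q1 q1E] := factor_theorem _ _ r1.
have [q2 q2E] := factor_theorem _ _ r2.
have q00 : q0 != 0 by apply: contraNneq p00 => q00; rewrite q0E q00 mul0r.
have [|s [k0 [k1 [k2 [s0 kN H0 H1 H2]]]]] := IH q0 q1 q2 _ q00.
  by rewrite q0E size_Mmonic ?monicXsubC // size_XsubC addn2 in sp.
have xb0 := xb_neq0 M b.
exists (s / (x - cst C b)), k0, k1, k2; split=> //; first by rewrite mulf_neq0 ?invr_eq0.
- by rewrite q0E evM evXsubC mulrA -[_ * _ * s]mulrA [_ * s]mulrC mulrA mulfK.
- by rewrite q1E evM evXsubC mulrA -[_ * _ * s]mulrA [_ * s]mulrC mulrA mulfK.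
- by rewrite q2E evM evXsubC mulrA -[_ * _ * s]mulrA [_ * s]mulrC mulrA mulfK.
Qed.

(* h is a root of a nonzero quadratic polynomial over K[x]; after a scaling of
   its coefficients it reduces at Q to a nonzero polynomial over K. *)
Lemma residue Q h : vge Q 0 h -> exists c, vge Q 1 (h - cst C c).
Proof.
move=> hQ; have [A [B [d [d0 hd]]]] := model_gen M h.
have d20 : d ^+ 2 != 0 by rewrite expf_neq0.
(* From h d = A + B y, [h] is a root of d^2 T^2 - 2 A d T + (A^2 - B^2 f). *)
have [s [k0 [k1 [k2 [s0 kN H0 H1 H2]]]]] :=
  common_scaling Q (- (2%:R *: A * d)) (A ^+ 2 - B ^+ 2 * f) d20.
apply: (@root_near _ _ Q h (k0 *: 'X^2 + k1 *: 'X + k2%:P)) => //.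
  apply: contraNneq kN => /polyP G0.
  move: (G0 2%N) (G0 1%N) (G0 0%N); rewrite !(coefD, coefZ, coefXn, coefX, coefC) /=.
  by rewrite !(mulr0, mulr1, addr0, add0r, coef0) => -> -> ->; rewrite eqxx.
have -> : ev h (k0 *: 'X^2 + k1 *: 'X + k2%:P) =
   - ((ev x (d ^+ 2) * s - cst C k0) * h ^+ 2 +
     ((ev x (- (2%:R *: A * d)) * s - cst C k1) * h +
      (ev x (A ^+ 2 - B ^+ 2 * f) * s - cst C k2))).
  have := quadratic_evy A B; rewrite -hd => hq.
  have -> : ev x (A ^+ 2 - B ^+ 2 * f) = 2%:R * ev x A * (h * ev x d) - (h * ev x d) ^+ 2.
    by rewrite hq; ring.
  rewrite !(evD, evZ, evN, evM, evXn, evX, evC) rmorph_nat; ring.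
rewrite vgeN vgeD //; first by rewrite -[1]addr0 vgeM ?vgeX.
by rewrite vgeD // -[1]addr0 vgeM.
Qed.

Hypotheses (sqf : squarefree f) (two : 2%:R != 0 :> K).

(* K[x] + K[x] y is integrally closed because f is squarefree. *)
Lemma regular_evy h : (forall Q, Q != P -> vge Q 0 h) -> exists A B, h = ey A B.
Proof.
move=> hR; have [A [B [d [d0 hd]]]] := model_gen M h.
have [n] := ubnP (size d); elim: n A B d d0 hd => // n IH A B d d0 hd sd.
have [d1|/closed_rootP[b db]] := eqVneq (size d) 1.
  move/eqP: d1 => /size_poly1P[k k0 dE]; exists (k^-1 *: A), (k^-1 *: B).
  move: hd; rewrite dE evC => hd.
  rewrite /evy !evZ -mulrA -mulrDr -/(evy x y A B) -hd mulrCA -rmorphM mulVf //.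
  by rewrite rmorph1 mulr1.
have [d1 d1E] := factor_theorem _ _ db.
have d10 : d1 != 0 by apply: contraNneq d0 => d10; rewrite d1E d10 mul0r.
have xb0 := xb_neq0 M b.
have dx10 := model_ev_neq0 M d10.
(* h d = A + B y vanishes at every place over b at least as much as x - b, which divides d. The aim
   is that A and B both vanish at b, so that x - b cancels. *)
have key Q c (bc : c ^+ 2 = f.[b]) (Qc : centered b c Q) :
    vge Q (Q (x - cst C b)) (ey A B).
  rewrite -hd d1E evM evXsubC mulrA -[X in vge Q X _]add0r vgeM ?vge_refl //.
  have QP := centered_neq Qc.
  by rewrite -[0]addr0 vgeM ?hR // vge_ev // (place_finite M).
have [c bc] := exists_sqrt f.[b].
have bcN : (- c) ^+ 2 = f.[b] by rewrite sqrrN.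
have AB0 : A.[b] = 0 /\ B.[b] = 0.
  have vl c' : c' ^+ 2 = f.[b] -> A.[b] + B.[b] * c' = 0.
    move=> bc'; have [Q Qc] := centered_exists M sqf two bc'.
    have H1 : vge Q 1 (ey A B).
      apply: vge_le (key _ _ bc' Qc).
      by rewrite (centered_xb M sqf two bc' Qc); case: ifP.
    apply: (@vge1_cst Q); have [Qx Qy] := Qc.
    have := rv_vge Qx Qy (rv_evy x y b c' A B).
    by move/(vgeB H1); rewrite opprB addrC subrK.
  have [c0|c0] := eqVneq c 0; last first.
    have e1 := vl c bc; have e2 := vl (- c) bcN.
    have Ab : A.[b] = 0.
      have : 2%:R * A.[b] = 0 by rewrite -[RHS]addr0 -{1}e1 -e2; ring.
      by move/eqP; rewrite mulf_eq0 (negbTE two) => /eqP.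
    by split=> //; move/eqP: e1; rewrite Ab add0r mulf_eq0 (negbTE c0) orbF => /eqP.
  (* A branch point gives one value only, but there x - b has order 2: A + B y and A have order at
     least 2, hence so has B y, whereas y has order 1. *)
  have Ab : A.[b] = 0 by rewrite -(vl c bc) c0 mulr0 addr0.
  split=> //; have [Q Qc] := centered_exists M sqf two bc.
  have fb0 : f.[b] = 0 by rewrite -bc c0 expr0n.
  have Qx2 := centered_xb M sqf two bc Qc; rewrite fb0 eqxx in Qx2.
  have := centered_t M sqf two bc Qc; rewrite /uniformizer fb0 eqxx => Qy.
  have := key _ _ bc Qc; rewrite Qx2 => H2.
  have [A1 A1E] := factor_theorem _ _ (introT rootP Ab).
  have Qx := place_finite M (centered_neq Qc).
  have HA : vge Q 2 (ev x A).
    by rewrite A1E evM evXsubC -[2]add0r vgeM ?vge_ev // -Qx2 vge_refl.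
  have HB : vge Q 2 (ev x B * y) by have := vgeB H2 HA; rewrite /evy addrC addKr.
  apply/eqP; apply: contraTT HB => Bb.
  have [Bx0 QB] := place_of_vge1 Bb (vge_ev_sub B Qc.1).
  by rewrite vgeE ?mulf_neq0 ?(model_y0 M) // placeM ?(model_y0 M) // QB Qy.
have [A1 A1E] := factor_theorem _ _ (introT rootP AB0.1).
have [B1 B1E] := factor_theorem _ _ (introT rootP AB0.2).
apply: (IH A1 B1 d1) => //; last first.
  by move: sd; rewrite d1E size_Mmonic ?monicXsubC // size_XsubC addn2.
apply: (mulIf xb0); move: hd; rewrite d1E A1E B1E /evy !evM evXsubC mulrA => ->.
by ring.
Qed.

End Residue.

(** * The genus of the model *)

Section Genus.
Local Open Scope ring_scope.

Section Span.
Variables (K : closedFieldType) (C : curve K).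

Definition spanned n (L : set C) : Prop := exists e : 'I_n -> C,
  forall h, L h -> exists a : 'I_n -> K, h = \sum_(i < n) cst C (a i) * e i.

Lemma spanned_indep n k (L : set C) (w : 'I_k -> C) : spanned n L ->
  (forall i, L (w i)) ->
  (forall r : 'I_k -> K, \sum_(i < k) cst C (r i) * w i = 0 -> forall i, r i = 0) ->
  (k <= n)%N.
Proof.
move=> [e eL] wL wI; rewrite leqNgt; apply/negP => nk.
pose a i := projT1 (cid (eL _ (wL i))).
have aE i : w i = \sum_(j < n) cst C (a i j) * e j by rewrite /a; case: cid.
pose A := \matrix_(i < k, j < n) a i j.
have : kermx A != 0.
  by rewrite -mxrank_eq0 mxrank_ker -lt0n subn_gt0 (leq_ltn_trans (rank_leq_col A)).
case/rowV0Pn => v /sub_kermxP vA v0; case/eqP: v0; apply/rowP => i; rewrite mxE.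
apply: (wI (v 0)); under eq_bigr do rewrite aE mulr_sumr.
rewrite exchange_big big1 //= => j _.
under eq_bigr do rewrite mulrA -rmorphM.
rewrite -mulr_suml -rmorph_sum /=.
move/rowP/(_ j): vA; rewrite !mxE => vAj.
rewrite (eq_bigr (fun i => v 0 i * A i j)) ?vAj ?rmorph0 ?mul0r // => i' _.
by rewrite mxE.
Qed.

Lemma sum_monomials_eq0 k (r : 'I_k -> K) :
  \sum_(i < k) r i *: 'X^i = 0 -> forall i, r i = 0.
Proof.
move=> s0 i; have /(congr1 (fun p : {poly K} => p`_i)) := s0.
rewrite coef0 coef_sum (bigD1 i) //= coefZ coefXn eqxx mulr1 big1 ?addr0 // => j ji.
by rewrite coefZ coefXn eq_sym (inj_eq val_inj) (negbTE ji) mulr0.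
Qed.

Lemma RRspaceE D h : RRspace D h <-> forall Q : point C, vge Q (- coeff Q D) h.
Proof.
split=> [[->|hD] Q|hD]; first exact: vge0.
  by rewrite /vge; apply/orP; right; have := hD Q; lia.
have [->|h0] := eqVneq h 0; [by left | right => Q].
by have := hD Q; rewrite vgeE //; lia.
Qed.

Lemma effectiveE (E : {freeg (point C) / int}) : (forall Q, 0 <= coeff Q E) ->
  exists2 l : seq (point C), E = \sum_(Q <- l) << Q >> & deg E = (size l)%:Z.
Proof.
move=> E0.
have [l lE] : exists l : seq (point C), E = \sum_(Q <- l) << Q >>.
  rewrite -[E]freeg_sumE.
  apply: (big_ind (fun E' => exists l : seq (point C), E' = \sum_(Q <- l) << Q >>)).
  - by exists [::]; rewrite big_nil.
  - by move=> _ _ [l1 ->] [l2 ->]; exists (l1 ++ l2); rewrite big_cat.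
  move=> Q _; exists (nseq `|coeff Q E| Q).
  rewrite -{1}(gez0_abs (E0 Q)); elim: `|_|%N => [|k IH].
    by rewrite big_nil freegU0.
  by rewrite /= big_cons -IH freegUD.
exists l => //; rewrite lE raddf_sum /=; elim: l {lE} => [|Q l IH].
  by rewrite big_nil.
by rewrite big_cons IH degU /=; lia.
Qed.

End Span.

Variables (K : closedFieldType) (C : curve K) (P : point C).
Variables (x y : C) (f : {poly K}) (m : nat).
Hypotheses (M : is_model P x y f m) (sqf : squarefree f) (two : 2%:R != 0 :> K).
Implicit Types (Q : point C) (A B d p : {poly K}) (a b c : K).
Implicit Types (D E : {freeg (point C) / int}).

Local Notation ey := (evy x y).
Local Notation centered := (centered x y).

(** An element u of L(D + Q) outside L(D) has the least order allowed at Q; if c is the residue at Q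
    of h / u, then h - c u lies in L(D). So one more generator is enough. *)
Lemma spanned_addU D Q n : spanned n (RRspace D) -> spanned n.+1 (RRspace (D + << Q >>)).
Proof.
have cD R : coeff R (D + << Q >>) = coeff R D + (Q == R)%:R.
  by rewrite coeffD coeffU mul1r.
move=> [e eD]; have [sub|] := pselect (forall h, RRspace (D + << Q >>) h -> RRspace D h).
  exists (fun i => if unlift ord0 i is Some j then e j else 0) => h /sub/eD[a ->].
  exists (fun i => if unlift ord0 i is Some j then a j else 0).
  by rewrite big_ord_recl unlift_none mulr0 add0r; apply: eq_bigr => i _; rewrite liftK.
move=> /existsNP[u /not_implyP[/RRspaceE uDQ /RRspaceE uD]].
have uR R : R != Q -> vge R (- coeff R D) u.
  by move=> RQ; have := uDQ R; rewrite cD eq_sym (negbTE RQ) addr0.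
have uQ : vge Q (- coeff Q D - 1) u by have := uDQ Q; rewrite cD eqxx opprD.
have {uD} nuQ : ~~ vge Q (- coeff Q D) u.
  by apply/negP => uQ'; apply: uD => R; have [->|/uR] := eqVneq R Q.
have u0 : u != 0 by apply: contraNneq nuQ => ->; apply: vge0.
have Qu : Q u = - coeff Q D - 1 by move: uQ nuQ; rewrite !vgeE //; lia.
exists (fun i => if unlift ord0 i is Some j then e j else u) => h /RRspaceE hDQ.
have [|c hc] := @residue _ _ _ _ _ _ _ M Q (h / u).
  have := hDQ Q; rewrite cD eqxx => hQ; have := vgeM hQ (vge_refl Q u^-1).
  by rewrite placeV Qu; apply: vge_le; lia.
have /eD[a aE] : RRspace D (h - cst C c * u).
  apply/RRspaceE => R; have [->|RQ] := eqVneq R Q.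
    have -> : h - cst C c * u = (h / u - cst C c) * u by rewrite mulrBl divfK.
    by have := vgeM hc (vge_refl Q u); rewrite Qu; apply: vge_le; lia.
  rewrite vgeB //; last by rewrite -[X in vge _ X _]add0r vgeM ?vge_cst ?uR.
  by have := hDQ R; rewrite cD eq_sym (negbTE RQ) addr0.
exists (fun i => if unlift ord0 i is Some j then a j else c).
rewrite big_ord_recl unlift_none; under eq_bigr do rewrite liftK.
by rewrite -aE addrC subrK.
Qed.

Lemma spanned_add_effective D E n k : (forall Q, 0 <= coeff Q E) -> deg E = k%:Z ->
  spanned n (RRspace D) -> spanned (n + k) (RRspace (D + E)).
Proof.
move=> /effectiveE[l -> ->] [<-]; elim: l D n => [|Q l IH] D n sD.
  by rewrite big_nil addr0 addn0.
by rewrite big_cons addrA addnS -addSn; apply/IH/spanned_addU.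
Qed.

(** The divisor is the sum of the points (b, c) and (b, -c), that is, twice the branch point when c
    = 0. *)
Lemma fiber b : exists F : {freeg (point C) / int}, [/\ deg F = 2,
  forall Q, 0 <= coeff Q F & forall Q, Q != P -> Q (x - cst C b) <= coeff Q F].
Proof.
have [c bc] := exists_sqrt f.[b].
have bcN : (- c) ^+ 2 = f.[b] by rewrite sqrrN.
have [Q1 Q1c] := centered_exists M sqf two bc.
have [Q2 Q2c] := centered_exists M sqf two bcN.
exists (<< Q1 >> + << Q2 >>); split.
- by rewrite degD !degU.
- by move=> Q; rewrite coeffD !coeffU; case: eqP; case: eqP.
move=> Q QP; rewrite coeffD !coeffU !mul1r.
have [Qx|] := boolP (vge Q 1 (x - cst C b)); last first.
  by rewrite vgeE ?(xb_neq0 M) //; case: eqP; case: eqP; lia.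
have [c' bc' Qc'] := place_y_value M Qx.
rewrite (centered_xb M sqf two bc' Qc').
have /orP[/eqP cc|/eqP cc] : (c' == c) || (c' == - c) by rewrite -eqf_sqr bc' bc.
- rewrite cc in Qc'; have e1 := centered_uniq M sqf two bc Q1c Qc'.
  rewrite e1 eqxx; case: ifP => [fb0|_]; last by case: eqP.
  have c0 : c = 0 by apply/eqP; rewrite -sqrf_eq0 bc.
  rewrite c0 oppr0 -c0 in Q2c.
  by rewrite (centered_uniq M sqf two bc Q2c Qc') eqxx.
- rewrite cc in Qc'; have e1 := centered_uniq M sqf two bcN Q2c Qc'.
  rewrite e1 eqxx; case: ifP => [fb0|_]; last by case: eqP.
  have c0 : c = 0 by apply/eqP; rewrite -sqrf_eq0 bc.
  rewrite c0 oppr0 in bcN Qc'; rewrite c0 in Q1c.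
  by rewrite (centered_uniq M sqf two bcN Q1c Qc') eqxx.
Qed.

Definition dominated D := exists (bs : seq K) (F : {freeg (point C) / int}) (N0 : nat),
  [/\ deg F = (2 * size bs)%:Z,
      forall Q, Q != P -> Q (ev x (\prod_(b <- bs) ('X - b%:P))) <= coeff Q F,
      forall Q, Q != P -> coeff Q D <= coeff Q F &
      0 <= coeff P F /\ coeff P D <= coeff P F + N0%:Z - (2 * size bs)%:Z].

Lemma dominating_divisor D : dominated D.
Proof.
rewrite -[D]freeg_sumE; apply: (big_ind dominated).
- exists [::], 0, 0%N; rewrite deg0 big_nil ev1; split=> //.
  + by move=> Q _; rewrite place1 coeff0.
  + by rewrite !coeff0.
- move=> D1 D2 [bs [F [N [dF FQ FD [FP0 FP]]]]] [bs' [F' [N' [dF' FQ' FD' [FP0' FP']]]]].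
  exists (bs ++ bs'), (F + F'), (N + N')%N; split.
  + by rewrite degD dF dF' size_cat; lia.
  + move=> Q QP; rewrite big_cat evM placeM ?(model_ev_neq0 M) ?monic_neq0 ?monic_prod_XsubC //.
    by rewrite coeffD lerD ?FQ ?FQ'.
  + by move=> Q QP; rewrite !coeffD lerD ?FD ?FD'.
  + by rewrite !coeffD size_cat; lia.
move=> R _; set k := coeff R _.
have [->|RP] := eqVneq R P.
  exists [::], 0, `|k|%N; rewrite deg0 big_nil ev1; split=> //.
  + by move=> Q _; rewrite place1 coeff0.
  + by move=> Q QP; rewrite coeffU coeff0 eq_sym (negbTE QP) mulr0.
  + by rewrite coeffU coeff0 eqxx mulr1 /=; split=> //; lia.
have [b Rb] := finite_place_x M RP.
have [F [dF F0 FQ]] := fiber b.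
have RF : 1 <= coeff R F.
  by apply: le_trans (FQ R RP); move: Rb; rewrite vgeE ?(xb_neq0 M).
exists (nseq `|k| b), (F *+ `|k|), (2 * `|k|)%N; rewrite size_nseq; split.
- by rewrite degMn dF; lia.
- move=> Q QP; rewrite coeffMn big_nseq; elim: `|k|%N => [|j IH].
    by rewrite ev1 place1.
  rewrite iterS evM placeM ?evXsubC ?(xb_neq0 M) ?mulrS ?lerD ?FQ //.
  rewrite (model_ev_neq0 M) // iter_mulr_1 expf_neq0 // polyXsubC_eq0 //.
- move=> Q QP; rewrite coeffMn coeffU; case: eqP => [<-|_].
    by rewrite mulr1 pmulrn mulrzz; have := F0 R; nia.
  by rewrite mulr0 mulrn_wge0.
- rewrite coeffMn coeffU (negbTE RP) mulr0; have := mulrn_wge0 `|k|%N (F0 P); lia.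
Qed.

(** Enlarging D to D2 of degree 2 n0 raises the dimension by at most deg D2 - deg D, while L(D2)
    contains the 2 n0 + 1 - m independent functions x^i / d with i <= n0 and x^j y / d with j < n0 -
    m. The bound on j comes from the pole order 2j + 2m + 1 <= 2 n0. *)
Lemma genus_le D n : K_dim (RRspace D) n -> deg D + 1 - n%:Z <= m%:Z.
Proof.
move=> [e _ eD]; have {eD} sD : spanned n (RRspace D).
  by exists e => h /eD[a [-> _]]; exists a.
have [bs [F [N0 [dF FQ FD [FP0 FP]]]]] := dominating_divisor D.
pose n0 := (N0 + m)%N.
pose D2 := F + << ((2 * n0)%:Z - (2 * size bs)%:Z) *g P >>.
have D2Q Q : Q != P -> coeff Q D2 = coeff Q F.
  by move=> QP; rewrite coeffD coeffU eq_sym (negbTE QP) mulr0 addr0.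
have D2P : coeff P D2 = coeff P F + ((2 * n0)%:Z - (2 * size bs)%:Z).
  by rewrite coeffD coeffU eqxx mulr1.
have dD2 : deg D2 = (2 * n0)%:Z by rewrite degD degU dF; lia.
have E0 Q : 0 <= coeff Q (D2 - D).
  rewrite coeffB; have [->|QP] := eqVneq Q P; first by rewrite D2P; lia.
  by rewrite D2Q // subr_ge0 FD.
have [k dE] : exists k : nat, deg (D2 - D) = k%:Z.
  by have [l _ ->] := effectiveE E0; exists (size l).
have := spanned_add_effective E0 dE sD; rewrite addrC subrK => sD2.
pose d := \prod_(b <- bs) ('X - b%:P).
have d0 : d != 0 by rewrite monic_neq0 ?monic_prod_XsubC.
have dx0 := model_ev_neq0 M d0.
have [Px Py _] := place_pole_normalized M (model_pole M).
have x0 : x != 0 by rewrite -(evX x) (model_ev_neq0 M) ?polyX_eq0.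
have y0 := model_y0 M.
have Pd : P (ev x d) = - (2 * size bs)%:Z.
  have [_ ->] := place_ev_pole (model_pole M) d0.
  by rewrite size_prod_XsubC Px pmulrn mulrzz; lia.
have inD2 A B : vge P (- (2 * n0)%:Z) (ey A B) -> RRspace D2 (ey A B / ev x d).
  move=> AB; apply/RRspaceE => Q; have [->|QP] := eqVneq Q P.
    have := vgeM AB (vge_refl P (ev x d)^-1); rewrite placeV Pd D2P.
    by apply: vge_le; lia.
  have : vge Q 0 (ey A B).
    have Qx := place_finite M QP.
    rewrite vgeD ?vge_ev // -[0]addr0 vgeM ?vge_ev //.
    have : vge Q 0 (y ^+ 2) by rewrite (model_eq M) vge_ev.
    by rewrite !vgeE ?expf_neq0 // placeX; lia.
  move/vgeM/(_ (vge_refl Q (ev x d)^-1)); rewrite placeV add0r D2Q //.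
  by apply: vge_le; rewrite lerN2 FQ.
pose w (i : 'I_(n0.+1 + (n0 - m))) : C :=
  match split i with inl i => ev x 'X^i | inr j => ev x 'X^j * y end / ev x d.
have wl i : w (lshift _ i) = ey 'X^i 0 / ev x d.
  by rewrite /w; case: splitP => [j /= /val_inj <-|j /= ij]; rewrite ?evy_ev //; have := ltn_ord i; lia.
have wr j : w (rshift _ j) = ey 0 'X^j / ev x d.
  rewrite /w; case: splitP => [i /= ij|i /= /addnI/val_inj <-]; rewrite ?evy_0 //.
  by have := ltn_ord i; lia.
have le : (n0.+1 + (n0 - m) <= n + k)%N.
  apply: (spanned_indep (w := w)) sD2 _ _ => [i|r].
    rewrite -(splitK i); case: (split i) => j; rewrite /unsplit ?wl ?wr; apply: inD2.
      rewrite evy_ev evXn evX vgeE ?expf_neq0 // placeX Px pmulrn mulrzz.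
      by have := ltn_ord j; lia.
    rewrite evy_0 evXn evX vgeE ?mulf_neq0 ?expf_neq0 // placeM ?expf_neq0 //.
    rewrite placeX Px Py pmulrn mulrzz.
    by have := ltn_ord j; rewrite /n0; lia.
  rewrite big_split_ord /=.
  under eq_bigr do rewrite wl mulrA.
  under [X in _ + X]eq_bigr do rewrite wr mulrA.
  rewrite -!mulr_suml -mulrDl => /eqP; rewrite mulf_eq0 invr_eq0 (negbTE dx0) orbF => /eqP r0.
  have : ey (\sum_i r (lshift _ i) *: 'X^i) (\sum_j r (rshift _ j) *: 'X^j) = 0.
    rewrite -[RHS]r0 /evy !ev_sum mulr_suml; congr (_ + _); apply: eq_bigr => i _.
      by rewrite evZ ev0 mul0r addr0.
    by rewrite evZ ev0 add0r mulrA.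
  move=> /(evy_eq0 M)[/sum_monomials_eq0 rl /sum_monomials_eq0 rr] i.
  by rewrite -(splitK i); case: (split i) => j; rewrite /unsplit ?rl ?rr.
by move: dE; rewrite degB dD2; move: le; rewrite /n0; lia.
Qed.

(** The divisor 2m P attains the bound: its functions are the polynomials in x of degree at most m,
    since y already has a pole of order 2m + 1. *)
Lemma genus_ge : exists D n, K_dim (RRspace D) n /\ deg D + 1 - n%:Z = m%:Z.
Proof.
exists << (2 * m)%:Z *g P >>, m.+1; split; last by rewrite degU; lia.
have [Px Py PQ] := place_pole_normalized M (model_pole M).
have x0 : x != 0 by rewrite -(evX x) (model_ev_neq0 M) ?polyX_eq0.
exists (fun i : 'I_m.+1 => x ^+ i) => [i|h /RRspaceE hD].
  apply/RRspaceE => Q; have [->|QP] := eqVneq Q P; rewrite coeffU.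
    rewrite eqxx mulr1 vgeE ?expf_neq0 // placeX Px pmulrn mulrzz.
    by have := ltn_ord i; lia.
  by rewrite eq_sym (negbTE QP) mulr0 oppr0 vgeX // (place_finite M).
have [Q QP|A [B hE]] := regular_evy M sqf two (h := h).
  by have := hD Q; rewrite coeffU eq_sym (negbTE QP) mulr0 oppr0.
have := hD P; rewrite coeffU eqxx mulr1 => hP.
have [B0 sA] : B = 0 /\ (size A <= m.+1)%N.
  have [AB|] := boolP ((A != 0) || (B != 0)); last first.
    by rewrite negb_or !negbK => /andP[/eqP-> /eqP->]; rewrite size_poly0.
  have [e0 Pe] := PQ A B AB; move: hP; rewrite hE vgeE // Pe /pole_order.
  case: (eqVneq B 0) => [->|_]; first by split=> //; lia.
  by case: ifP => _; lia.
have hA (a : {ffun 'I_m.+1 -> K}) : \sum_(i < m.+1) cst C (a i) * x ^+ i =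
    ev x (\sum_(i < m.+1) a i *: 'X^i).
  by rewrite ev_sum; apply: eq_bigr => i _; rewrite evZ evXn evX.
exists [ffun i : 'I_m.+1 => A`_i]; split.
  rewrite hA hE B0 evy_ev; congr ev; rewrite -[LHS](coefK) poly_def.
  rewrite (big_ord_widen m.+1 (fun i => A`_i *: 'X^i)) // big_mkcond /=.
  apply: eq_bigr => i _; rewrite ffunE; case: ltnP => // Ai.
  by rewrite nth_default // scale0r.
move=> a' ha'; apply/ffunP => i; rewrite ffunE.
have : ev x (A - \sum_(i < m.+1) a' i *: 'X^i) = 0.
  by rewrite evB -hA -ha' hE B0 evy_ev subrr.
move/eqP; apply: contraTeq => Ai; apply: (model_ev_neq0 M).
rewrite subr_eq0; apply: contraNneq Ai => ->.
rewrite coef_sum (bigD1 i) //= coefZ coefXn eqxx mulr1 big1 ?addr0 // => j ji.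
by rewrite coefZ coefXn eq_sym (inj_eq val_inj) (negbTE ji) mulr0.
Qed.

Lemma genus_model g : has_genus C g -> g = m.
Proof.
move=> [Hle [D [n [Dn Dg]]]]; have [D' [n' [Dn' Dm]]] := genus_ge.
by have := Hle _ _ Dn'; have := genus_le Dn; lia.
Qed.

End Genus.

(** * Points of order 2m+1 *)

Section Torsion.
Local Open Scope ring_scope.
Variables (K : closedFieldType) (C : curve K) (P : point C).

Lemma principal_of_order Q d : has_order (abel_jacobi P Q) d ->
  is_principal (point_diff Q P *+ d).
Proof.
move=> [_ Qd _]; pose D : div0 C := Div0 (point_diff_degree_zero Q P).
have : (D *+ d - 0) \in @principal0 K C.
  by rewrite (Quotient.idealrBE (@principal0 K C)) raddfMn /= raddf0; apply/eqP.
rewrite subr0 inE => /asboolP.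
have e : val (D *+ d) = point_diff Q P *+ d.
  by elim: d {Qd} => [|d IH]; rewrite ?mulr0n ?GRing.val0 // !mulrS GRing.valD IH.
by move=> /asboolP; rewrite e.
Qed.

Lemma order_gt1_neq Q d : (1 < d)%N -> has_order (abel_jacobi P Q) d -> Q != P.
Proof.
move=> d1 [_ _ /(_ 1%N)]; rewrite d1 mulr1n => /(_ isT) nz; apply: contraNneq nz => ->.
pose D : div0 C := Div0 (point_diff_degree_zero P P).
apply/eqP; rewrite -[RHS](raddf0 (\pi_(jacobian C))%qT).
congr (\pi_(jacobian C))%qT; apply: val_inj.
by rewrite GRing.val0 /= /point_diff subrr.
Qed.

Variables (x y : C) (f : {poly K}) (m : nat).
Hypotheses (M : is_model P x y f m) (sqf : squarefree f) (two : 2%:R != 0 :> K).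
Hypotheses (fmonic : f \is monic).
Implicit Types (Q R : point C) (A B d p v : {poly K}) (a b c : K).

Local Notation ey := (evy x y).

(* The function with divisor (2m+1)(Q - P) is a multiple of y - v(x); its norm
   v^2 - f vanishes only at x(Q). *)
Lemma torsion_point Q : (0 < m)%N -> points_of_order P (2 * m + 1) Q ->
  exists b v, [/\ (size v <= m.+1)%N, f = ('X - b%:P) ^+ (2 * m + 1) + v ^+ 2 &
    centered x y b v.[b] Q].
Proof.
move=> m0 Qo; have QP : Q != P by apply: order_gt1_neq Qo; lia.
have [h h0 hD] := principal_of_order Qo.
have {}hD R : R h = (((Q == R)%:R - (P == R)%:R) *+ (2 * m + 1))%R :> int.
  by rewrite -hD /point_diff coeffMn coeffB !coeffU !mul1r.
have [R RP|A [B hE]] := regular_evy M sqf two (h := h).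
  by rewrite vgeE // hD [P == R]eq_sym (negbTE RP) subr0 mulrn_wge0 //.
have AB : (A != 0) || (B != 0).
  rewrite -negb_and; apply: contraNN h0 => /andP[/eqP A0 /eqP B0].
  by rewrite hE A0 B0 evy_ev ev0.
have [Px Py HP] := place_pole_normalized M (model_pole M).
have [_] := HP A B AB; rewrite -hE hD eqxx (negbTE QP) sub0r => po.
have {}po : pole_order m A B = (2 * m + 1)%N by move: po; rewrite mulNrn; lia.
(* The pole order 2m + 1 is odd, so the term B y attains it and B is a nonzero constant. *)
have [B1 sA] : size B = 1%N /\ (size A <= m.+1)%N.
  move: po; rewrite /pole_order; case: (eqVneq B 0) => [_|B0]; first lia.
  have sB : (0 < size B)%N by rewrite size_poly_gt0.
  case: (eqVneq A 0) => [->|_]; first by rewrite size_poly0; lia.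
  lia.
move/eqP: B1 => /size_poly1P[k k0 BE].
pose v := - (k^-1 *: A).
have vE : y - ev x v = cst C k^-1 * h.
  by rewrite hE BE /evy evC evN evZ opprK mulrDr mulrA -rmorphM mulVf // rmorph1 mul1r addrC.
have sv : (size v <= m.+1)%N by rewrite size_polyN (leq_trans (size_scale_leq _ _)).
clearbody v; have v2 : (size (v ^+ 2) < size f)%N.
  by rewrite (model_size M) expr2 (leq_ltn_trans (size_polyMleq v v)) //; move: sv; case: (size v) => [|k']; lia.
have [b [c [bc Qc]]] := finite_place_centered M QP.
have [r rE] := closed_field_poly_normal (f - v ^+ 2).
have rmonic : lead_coef (f - v ^+ 2) = 1.
  by rewrite lead_coefDl ?size_polyN // (monicP fmonic).
have sr : size r = (2 * m + 1)%N.
  have : size (f - v ^+ 2) = size f by rewrite size_polyDl ?size_polyN.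
  by rewrite rE rmonic scale1r size_prod_XsubC (model_size M); lia.
(* The function h vanishes at the point (b', v(b')), which must therefore be Q. *)
have rb b' : b' \in r -> b' = b.
  move=> b'r; have : root (f - v ^+ 2) b'.
    by rewrite rE rmonic scale1r root_prod_XsubC.
  rewrite /root !hornerE subr_eq0 eq_sym => /eqP bc'.
  have [R [Rx Ry]] := centered_exists M sqf two bc'.
  have : vge R 1 h.
    have -> : h = cst C k * (y - ev x v).
      by rewrite vE mulrA -rmorphM mulfV // rmorph1 mul1r.
    rewrite -[1]add0r vgeM ?vge_cst //.
    have -> : y - ev x v = (y - cst C v.[b']) - (ev x v - cst C v.[b']) by ring.
    exact: (vgeB Ry (vge_ev_sub v Rx)).
  rewrite vgeE // hD; case: eqP => [QR _|_]; last first.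
    have := mulrn_wge0 (2 * m + 1) (ler0n int (P == R)).
    by rewrite sub0r mulNrn; move: (_ *+ _) => e; clear; lia.
  apply/eqP; rewrite -subr_eq0; apply/eqP/(@vge1_cst _ _ Q).
  have -> : cst C (b' - b) = (x - cst C b) - (x - cst C b') by rewrite rmorphB; ring.
  by rewrite vgeB //; [case: Qc | rewrite QR].
exists b, v; split=> //.
  rewrite -[LHS](subrK (v ^+ 2)) rE rmonic scale1r; congr (_ + _).
  rewrite -sr big_seq; elim: r rb {rE sr} => [|b' r IH] rb.
    by rewrite -big_seq big_nil expr0.
  rewrite -big_seq big_cons exprS (rb b') ?mem_head // big_seq IH // => b'' b''r.
  by apply: rb; rewrite in_cons b''r orbT.
have Qx := Qc.1; split=> //.
have -> : y - cst C v.[b] = (y - ev x v) + (ev x v - cst C v.[b]) by ring.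
rewrite vgeD ?vge_ev_sub // vE -[1]add0r vgeM ?vge_cst // vgeE // hD eqxx eq_sym (negbTE QP).
by rewrite subr0; lia.
Qed.

End Torsion.

(** * Models of hyperelliptic curves and their isomorphisms *)

Section Existence.
Local Open Scope ring_scope.

Lemma squarefree_part (K : closedFieldType) (p : {poly K}) : p != 0 ->
  exists F G, [/\ squarefree F, F \is monic, G != 0 & p = F * G ^+ 2].
Proof.
have [n] := ubnP (size p); elim: n p => // n IH p sp p0.
have [sq|] := pselect (squarefree p).
  have [r r2] := exists_sqrt (lead_coef p).
  have r0 : r != 0 by rewrite -sqrf_eq0 r2 lead_coef_eq0.
  have l0 : lead_coef p != 0 by rewrite lead_coef_eq0.
  exists ((lead_coef p)^-1 *: p), r%:P; split.
  - by move=> b; rewrite dvdpZr ?invr_eq0.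
  - by rewrite monicE lead_coefZ mulVf.
  - by rewrite polyC_eq0.
  - by rewrite -polyC_exp r2 mulrC mul_polyC scalerA mulfV // scale1r.
move=> /existsNP[b /negP]; rewrite negbK => /dvdpP[q qE].
have q0 : q != 0 by apply: contraNneq p0 => q0; rewrite qE q0 mul0r.
have [|F [G [sF mF G0 qF]]] := IH q _ q0.
  move: sp; rewrite qE size_Mmonic ?monic_exp ?monicXsubC // size_exp_XsubC.
  by move: q0; rewrite -size_poly_gt0; lia.
exists F, (G * ('X - b%:P)); split=> //; first by rewrite mulf_neq0 ?polyXsubC_eq0.
by rewrite qE qF; ring.
Qed.

Variables (K : closedFieldType) (C : curve K) (P : point C).
Hypothesis two : 2%:R != 0 :> K.

(** If a generator x0 of the fixed field takes a value a at [P], then 1 / (x0 - a) has the pole. If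
    x0 had neither a pole nor a value, [P] would be trivial on K(x0), although t * s t lies there
    and has value 2 for a uniformizer t. *)
Lemma hyperelliptic_pole (s : {rmorphism C -> C}) :
  hyperelliptic_involution s -> (forall h, P (s h) = P h) ->
  exists x, [/\ P x < 0, s x = x & forall h, s h = h -> ratfun_in (cst C) x h].
Proof.
move=> [sc sK _ [x0 x0T fixE]] Ps.
have fixP h : s h = h <-> ratfun_in (cst C) x0 h.
  by have := congr1 (fun A : set C => A h) fixE; rewrite /= => ->.
have ev0' p : p != 0 -> ev x0 p != 0 by apply: x0T.
have [neg|pos] := ltP (P x0) 0.
  exists x0; split=> // [|h /fixP//].
  by apply/fixP; rewrite -[X in ratfun_in _ _ X]evX; apply: ratfun_ev.
have x00 : x0 != 0 by rewrite -(evX x0) ev0' ?polyX_eq0.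
have {}pos : vge P 0 x0 by rewrite vgeE.
have [[a xa]|na] := pselect (exists a, vge P 1 (x0 - cst C a)).
  have xa0 : x0 - cst C a != 0 by rewrite -evXsubC ev0' ?polyXsubC_eq0.
  exists (x0 - cst C a)^-1; split.
  - by rewrite placeV; move: xa; rewrite vgeE //; lia.
  - by apply/fixP/ratfunV; rewrite -evXsubC; apply: ratfun_ev.
  move=> h /fixP; apply: ratfun_trans.
  set z := _^-1; have -> : x0 = z^-1 + ev z a%:P by rewrite /z invrK evC subrK.
  apply: ratfunD; last exact: ratfun_ev.
  by apply: ratfunV; rewrite -[X in ratfun_in _ _ X]evX; apply: ratfun_ev.
have P0 p : p != 0 -> P (ev x0 p) = 0.
  move=> p0; have := vge_ev p pos; rewrite vgeE ?ev0' // le_eqVlt => /orP[/eqP//|p1].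
  by case: na; apply: (root_near p0 pos); rewrite vgeE ?ev0' //; lia.
have [t t0 Pt] := place_unif P.
have st0 : s t != 0 by rewrite fmorph_eq0.
have : s (t * s t) = t * s t by rewrite rmorphM sK mulrC.
move=> /fixP[p [q [q0 tE]]]; have := placeM P t0 st0.
rewrite Ps Pt tE; have ts0 : t * s t != 0 by rewrite mulf_neq0.
have px0 : ev x0 p != 0.
  by apply: contraNneq ts0; rewrite tE /ev => ->; rewrite mul0r.
have p0 : p != 0 by apply: contraNneq px0 => ->; rewrite ev0.
have qq0 : q != 0 by apply: contraNneq q0 => ->; rewrite rmorph0 horner0.
rewrite placeM ?invr_eq0 // placeV.
by have := P0 p p0; have := P0 q qq0; rewrite /ev => -> ->.
Qed.

(** An anti-invariant function has its square in K(x), and a factor from K(x) makes this square a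
    monic squarefree polynomial F. Splitting functions into invariant and anti-invariant parts gives
    K(x) + K(x) y. That F has odd degree is due to [P] being fixed by the involution. *)
Lemma hyperelliptic_model : weierstrass_point P ->
  exists x y f m, [/\ is_model P x y f m, squarefree f & f \is monic].
Proof.
move=> [s sH Ps]; have [x [Px sx fixx]] := hyperelliptic_pole sH Ps.
have [sc sK [h sh] _] := sH.
have twoC : 2%:R != 0 :> C by rewrite -(rmorph_nat (cst C)) fmorph_eq0.
have evn0 p : p != 0 -> ev x p != 0 by move=> /(place_ev_pole Px)[].
have sev p : s (ev x p) = ev x p.
  elim/poly_ind: p => [|p c IH]; first by rewrite ev0 rmorph0.
  by rewrite evD evM evX evC rmorphD rmorphM IH sx sc.
pose y0 := h - s h.
have y00 : y0 != 0 by rewrite subr_eq0 eq_sym.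
have sy0 : s y0 = - y0 by rewrite /y0 rmorphB sK opprB.
have [p [q [q0 y0E]]] : ratfun_in (cst C) x (y0 ^+ 2).
  by apply: fixx; rewrite rmorphXn sy0 sqrrN.
have qq0 : q != 0 by apply: contraNneq q0 => ->; rewrite rmorph0 horner0.
have pp0 : p != 0.
  apply: contraNneq (expf_neq0 2 y00) => p0.
  by rewrite y0E p0 rmorph0 horner0 mul0r.
have [F [G [sF mF G0 pqE]]] := squarefree_part (mulf_neq0 pp0 qq0).
pose y := ev x q * y0 / ev x G.
have y2 : y ^+ 2 = ev x F.
  have Gx := evn0 G G0; have qx : ev x q != 0 by [].
  rewrite /y !exprMn exprVn y0E -/(ev x p) -/(ev x q).
  have -> : ev x q ^+ 2 * (ev x p / ev x q) = ev x (p * q) by rewrite evM; field.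
  by rewrite pqE evM evXn mulfK ?expf_neq0.
have sy : s y = - y by rewrite /y !rmorphM fmorphV !sev sy0 mulrN mulNr.
have y0' : y != 0 by rewrite !mulf_neq0 ?invr_eq0 ?evn0.
have gen k : exists A B d, d != 0 /\ k * ev x d = evy x y A B.
  have [p1 [q1 [q10 e1]]] : ratfun_in (cst C) x ((k + s k) / 2%:R).
    by apply: fixx; rewrite rmorphM fmorphV rmorph_nat rmorphD sK addrC.
  have [p2 [q2 [q20 e2]]] : ratfun_in (cst C) x ((k - s k) / (2%:R * y)).
    apply: fixx; rewrite rmorphM fmorphV rmorphM rmorph_nat rmorphB sK sy mulrN.
    by rewrite invrN mulrN -mulNr opprB.
  have q1n : q1 != 0 by apply: contraNneq q10 => ->; rewrite rmorph0 horner0.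
  have q2n : q2 != 0 by apply: contraNneq q20 => ->; rewrite rmorph0 horner0.
  exists (p1 * q2), (p2 * q1), (q1 * q2); split; first by rewrite mulf_neq0.
  rewrite -!/(ev x _) in q10 q20 e1 e2.
  have -> : k = (k + s k) / 2%:R + (k - s k) / (2%:R * y) * y.
    by field; rewrite y0'.
  by rewrite e1 e2 /evy !evM; field; apply/andP.
exists x, y, F, ((size F).-1 ./2); split=> //; split=> //.
have F0 := monic_neq0 mF.
have sF0 : (0 < size F)%N by rewrite size_poly_gt0.
case oF : (odd (size F).-1).
  by rewrite -[LHS]prednK // -[in LHS](odd_double_half (size F).-1) oF mul2n.
pose k := (size F).-1./2; have sFk : size F = (2 * k).+1.
  by rewrite -[LHS]prednK // -[in LHS](odd_double_half (size F).-1) oF mul2n.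
have x0 : x != 0 by apply: contraTneq Px => ->; rewrite place0.
(* If deg F = 2k, then z^2 - 1 vanishes at [P]. The involution exchanges z - 1 and z + 1 up to sign
   and fixes [P], so both vanish there, and so does their difference 2. *)
pose z := y / x ^+ k.
have sz : s z = - z by rewrite /z rmorphM fmorphV rmorphXn sy sx mulNr.
have z1 : vge P 1 ((z - 1) * (z + 1)).
  have -> : (z - 1) * (z + 1) = ev x (F - 'X^(2 * k)) * x ^- (2 * k).
    have : x ^+ k != 0 by rewrite expf_neq0.
    by rewrite evB evXn evX -y2 /z mulnC exprM => xk; field.
  have [->|F'0] := eqVneq (F - 'X^(2 * k)) 0; first by rewrite ev0 mul0r vge0.
  have [Fx PF] := place_ev_pole Px F'0.
  rewrite vgeE ?mulf_neq0 ?invr_eq0 ?expf_neq0 // placeM ?invr_eq0 ?expf_neq0 //.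
  rewrite PF placeV placeX.
  have sF' : (size (F - 'X^(2 * k))%R <= 2 * k)%N.
    apply/leq_sizeP => j; rewrite leq_eqVlt coefB coefXn => /orP[/eqP<-|kj].
      by rewrite eqxx; have := monicP mF; rewrite lead_coefE sFk /= => ->; rewrite subrr.
    by rewrite gtn_eqF // subr0 nth_default // sFk.
  move: sF'; rewrite -size_poly_gt0 in F'0; move: F'0; move: (size (F - _)) => j.
  by rewrite !pmulrn !mulrzz; move: Px; move: (P x) => e; clear; nia.
have Pz : P (z - 1) = P (z + 1).
  by rewrite -Ps rmorphB rmorph1 sz -opprD placeN.
have zz : z + 1 - (z - 1) = cst C 2%:R by rewrite rmorph_nat; ring.
exfalso; move/eqP: two; apply; apply: (@vge1_cst _ _ P); rewrite -zz.
have z10 : z - 1 != 0.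
  apply/eqP => z10; have := congr1 s z10; rewrite rmorphB rmorph1 sz rmorph0 => z20.
  have : - (z - 1) - (- z - 1) = 2%:R by ring.
  by rewrite z10 z20 subr0 oppr0 => e; case/eqP: twoC.
have z20 : z + 1 != 0.
  apply: contraNneq z10 => z20; have := congr1 s z20.
  by rewrite rmorphD rmorph1 sz rmorph0 => e; rewrite -oppr_eq0 opprB addrC e.
move: z1; rewrite vgeE ?mulf_neq0 // placeM // => z1.
have P1 : 1 <= P (z + 1) by move: z1; rewrite Pz; move: (P _) => e; clear; lia.
by rewrite vgeB // vgeE // Pz.
Qed.

End Existence.

(** * Marked curves with the same equation are isomorphic *)

Section Isomorphism.
Local Open Scope ring_scope.
Variables (K : closedFieldType) (C1 C2 : curve K) (P1 : point C1) (P2 : point C2).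
Variables (x1 y1 : C1) (x2 y2 : C2) (f : {poly K}) (m : nat).
Hypotheses (M1 : is_model P1 x1 y1 f m) (M2 : is_model P2 x2 y2 f m).

(** The graph of the field isomorphism sending x2 to x1 and y2 to y1; it is a relation first because
    A, B and d are not unique. *)
Definition corresponds (h2 : C2) (h1 : C1) : Prop := exists A B d,
  [/\ d != 0, h2 * ev x2 d = evy x2 y2 A B & h1 * ev x1 d = evy x1 y1 A B].

Lemma evyZ (C : curve K) (x y : C) A B d : evy x y A B * ev x d = evy x y (A * d) (B * d).
Proof. by rewrite /evy !evM; ring. Qed.

Lemma corresponds_total h2 : exists h1, corresponds h2 h1.
Proof.
have [A [B [d [d0 hd]]]] := model_gen M2 h2.
exists (evy x1 y1 A B / ev x1 d), A, B, d; split=> //.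
by rewrite divfK // (model_ev_neq0 M1).
Qed.

Lemma corresponds_fun h2 h1 h1' : corresponds h2 h1 -> corresponds h2 h1' -> h1 = h1'.
Proof.
move=> [A [B [d [d0 e2 e1]]]] [A' [B' [d' [d'0 e2' e1']]]].
have : evy x2 y2 (A * d') (B * d') = evy x2 y2 (A' * d) (B' * d).
  by rewrite -!evyZ -e2 -e2'; ring.
move=> /(evy_inj M2)[eA eB].
have : evy x1 y1 A B * ev x1 d' = evy x1 y1 A' B' * ev x1 d by rewrite !evyZ eA eB.
rewrite -e1 -e1' mulrAC => /(mulIf (model_ev_neq0 M1 d0)).
by move/(mulIf (model_ev_neq0 M1 d'0)).
Qed.

Lemma correspondsD h2 h2' h1 h1' : corresponds h2 h1 -> corresponds h2' h1' ->
  corresponds (h2 + h2') (h1 + h1').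
Proof.
move=> [A [B [d [d0 e2 e1]]]] [A' [B' [d' [d'0 e2' e1']]]].
exists (A * d' + A' * d), (B * d' + B' * d), (d * d'); rewrite mulf_neq0 //.
by split=> //; rewrite -evyD -!evyZ -?e2 -?e2' -?e1 -?e1' evM; ring.
Qed.

Lemma correspondsM h2 h2' h1 h1' : corresponds h2 h1 -> corresponds h2' h1' ->
  corresponds (h2 * h2') (h1 * h1').
Proof.
move=> [A [B [d [d0 e2 e1]]]] [A' [B' [d' [d'0 e2' e1']]]].
exists (A * A' + B * B' * f), (A * B' + A' * B), (d * d'); rewrite mulf_neq0 //.
by split=> //; rewrite -?(evyM M1) -?(evyM M2) -?e2 -?e2' -?e1 -?e1' evM; ring.
Qed.

Lemma corresponds_cst a : corresponds (cst C2 a) (cst C1 a).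
Proof.
by exists a%:P, 0, 1; rewrite oner_eq0 !ev1 !mulr1 !evy_ev !evC.
Qed.

Lemma corresponds_place h2 h1 : corresponds h2 h1 -> P1 h1 = P2 h2.
Proof.
have [_ _ H1] := place_pole_normalized M1 (model_pole M1).
have [_ _ H2] := place_pole_normalized M2 (model_pole M2).
move=> [A [B [d [d0 e2 e1]]]].
have d1 := model_ev_neq0 M1 d0; have d2 := model_ev_neq0 M2 d0.
have [AB|] := boolP ((A != 0) || (B != 0)); last first.
  rewrite negb_or !negbK => /andP[/eqP A0 /eqP B0].
  move/eqP: e1; move/eqP: e2; rewrite A0 B0 !evy_ev !ev0 !mulf_eq0.
  by rewrite (negbTE d1) (negbTE d2) !orbF => /eqP-> /eqP->; rewrite !place0.
have [n1 E1] := H1 A B AB; have [n2 E2] := H2 A B AB.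
have [_ D1] := H1 d 0 (introT orP (or_introl d0)).
have [_ D2] := H2 d 0 (introT orP (or_introl d0)).
rewrite !evy_ev in D1 D2.
have h10 : h1 != 0 by apply: contraNneq n1; rewrite -e1 => ->; rewrite mul0r.
have h20 : h2 != 0 by apply: contraNneq n2; rewrite -e2 => ->; rewrite mul0r.
by move: E1 E2; rewrite -e1 -e2 !placeM // D1 D2 => E1 E2; apply: (addIr (- (pole_order m d 0)%:Z)); rewrite E1 E2.
Qed.

Definition transfer (h2 : C2) : C1 := projT1 (cid (corresponds_total h2)).

Lemma transferP h2 : corresponds h2 (transfer h2).
Proof. by rewrite /transfer; case: cid. Qed.

Lemma transferE h2 h1 : corresponds h2 h1 -> transfer h2 = h1.
Proof. exact: corresponds_fun (transferP h2). Qed.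

Lemma transfer_is_zmod_morphism : zmod_morphism transfer.
Proof.
move=> h k; apply: transferE; apply: correspondsD; first exact: transferP.
rewrite -mulN1r -[X in corresponds _ X]mulN1r; apply: correspondsM; last exact: transferP.
by have := corresponds_cst (- 1); rewrite !rmorphN !rmorph1.
Qed.

Lemma transfer_is_monoid_morphism : monoid_morphism transfer.
Proof.
split; first by apply: transferE; have := corresponds_cst 1; rewrite !rmorph1.
by move=> h k; apply/transferE/correspondsM; apply: transferP.
Qed.

HB.instance Definition _ := GRing.isZmodMorphism.Build C2 C1 transfer
  transfer_is_zmod_morphism.
HB.instance Definition _ := GRing.isMonoidMorphism.Build C2 C1 transfer
  transfer_is_monoid_morphism.

Definition transfer_morphism : {rmorphism C2 -> C1} := transfer.

End Isomorphism.

Lemma corresponds_sym (K : closedFieldType) (C1 C2 : curve K)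
    (x1 y1 : C1) (x2 y2 : C2) h2 h1 :
  corresponds x1 y1 x2 y2 h2 h1 -> corresponds x2 y2 x1 y1 h1 h2.
Proof. by move=> [A [B [d [? ? ?]]]]; exists A, B, d. Qed.

Lemma model_marked_iso (K : closedFieldType) (g : nat) (C1 C2 : marked_curve K g)
    (x1 y1 : C1) (x2 y2 : C2) f m :
  is_model (mpoint C1) x1 y1 f m -> is_model (mpoint C2) x2 y2 f m ->
  marked_iso C1 C2.
Proof.
move=> M1 M2; exists (transfer_morphism M1 M2); split.
- exists (transfer M2 M1) => h; apply: transferE; apply: corresponds_sym; exact: transferP.
- by move=> a; apply/transferE/corresponds_cst.
- by move=> h; apply/(corresponds_place M1 M2)/transferP.
Qed.

(** * Pencils of square roots *)

Section Covering.

Lemma cover_at_most2 (T : eqType) (S : T -> Prop) :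
  (forall x y z, S x -> S y -> S z -> [\/ x = y, x = z | y = z]) ->
  exists2 s : seq T, (size s <= 2)%N & forall x, S x -> x \in s.
Proof.
move=> S3; have [[x Sx]|nS] := pselect (exists x, S x); last first.
  by exists [::] => // x Sx; case: nS; exists x.
have [[y [Sy xy]]|nS] := pselect (exists y, S y /\ x <> y).
  exists [:: x; y] => // z Sz; rewrite !inE.
  by case: (S3 x y z Sx Sy Sz) => [//|->|->]; rewrite eqxx ?orbT.
exists [:: x] => // z Sz; rewrite inE; apply/eqP; apply: contrapT => zx.
by case: nS; exists z; split=> // xz; apply: zx.
Qed.

Lemma cover_seq (A T : eqType) (R : A -> T -> Prop) n (r : seq A) :
  (forall a, a \in r -> exists2 s : seq T, (size s <= n)%N & forall x, R a x -> x \in s) ->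
  exists2 s : seq T, (size s <= n * size r)%N & forall a x, a \in r -> R a x -> x \in s.
Proof.
elim: r => [|a r IH] H; first by exists [::].
have [s ss sR] := H a (mem_head _ _).
have [|s' ss' sR'] := IH; first by move=> b br; apply: H; rewrite in_cons br orbT.
exists (s ++ s'); first by rewrite size_cat mulnS leq_add.
move=> b x; rewrite in_cons mem_cat => /orP[/eqP->|br] bx; first by rewrite sR.
by rewrite (sR' b) ?orbT.
Qed.

End Covering.

(** * Splittings of the roots of X^q - (X - 1)^q and the equation for a *)

Section Pencil.
Local Open Scope ring_scope.
Variables (K : closedFieldType) (g : nat).
Hypotheses (g1 : (1 < g)%N) (two : 2%:R != 0 :> K).
Local Notation q := (2 * g + 1)%N.
Hypothesis q0 : q%:R != 0 :> K.

Definition power_gap : {poly K} := 'X^q - ('X - 1) ^+ q.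
Local Notation H := power_gap.

Variable rho : 'I_(2 * g) -> K.
Hypotheses (rho_inj : injective rho) (rho_root : forall i, root H (rho i)).
Implicit Types (I J : {set 'I_(2 * g)}) (p v : {poly K}) (a c : K).

Definition root_prod I : {poly K} := \prod_(i in I) ('X - (rho i)%:P).
Local Notation U := root_prod.

Lemma root_prodE I : U I = \prod_(z <- [seq rho i | i <- enum I]) ('X - z%:P).
Proof. by rewrite big_map big_enum. Qed.

Lemma monic_root_prod I : U I \is monic.
Proof. by rewrite root_prodE monic_prod_XsubC. Qed.

Lemma size_root_prod I : size (U I) = #|I|.+1.
Proof. by rewrite root_prodE size_prod_XsubC size_map -cardE. Qed.

Lemma root_root_prod I i : root (U I) (rho i) = (i \in I).
Proof. by rewrite root_prodE root_prod_XsubC mem_map ?mem_enum. Qed.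

Lemma root_root_prodP I x : root (U I) x -> exists2 i, i \in I & x = rho i.
Proof.
rewrite root_prodE root_prod_XsubC => /mapP[i]; rewrite mem_enum => iI ->.
by exists i.
Qed.

Lemma root_prod_lead I : (U I)`_#|I| = 1.
Proof. by have := monicP (monic_root_prod I); rewrite lead_coefE size_root_prod. Qed.

Lemma scale_root_prod I p : (size p <= #|I|.+1)%N ->
  (forall i, i \in I -> root p (rho i)) -> exists c, p = c *: U I.
Proof.
move=> sp pI; have : U I %| p.
  rewrite root_prodE; apply: uniq_roots_dvdp.
    by apply/allP => _ /mapP[i + ->]; rewrite mem_enum; apply: pI.
  by rewrite uniq_rootsE map_inj_uniq ?enum_uniq.
move=> /dvdpP[r pE]; have [r0|r0] := eqVneq r 0.
  by exists 0; rewrite pE r0 mul0r scale0r.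
have : (size r <= 1)%N.
  move: sp; rewrite pE size_Mmonic ?monic_root_prod // size_root_prod.
  by move: (size r) #|I| => n k; lia.
by move=> /size1_polyC rE; exists r`_0; rewrite pE rE coefC mul_polyC.
Qed.

Lemma root_prod_setC I : U I * U (~: I) = U [set: _].
Proof.
rewrite /U (bigID (mem I) (mem [set: _])) /=.
by congr (_ * _); apply: eq_bigl => i; rewrite !inE.
Qed.

Lemma power_gap_at0 : H.[0] = 1.
Proof.
by rewrite /power_gap !hornerE addn1 mul2n exprS mul0r -signr_odd /= odd_double expr1 opprK add0r.
Qed.

Lemma power_gap_at1 : H.[1] = 1.
Proof. by rewrite /power_gap !hornerE subrr expr0n addn1 /= expr1n subr0. Qed.

Lemma size_power_gap : (size H <= q)%N.
Proof.
apply/leq_sizeP => j; rewrite leq_eqVlt => /orP[/eqP<-|qj].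
  have m1 : 'X^q \is @monic K by apply: monicXn.
  have m2 : ('X - 1%:P) ^+ q \is @monic K by rewrite monic_exp ?monicXsubC.
  rewrite coefB; move: (monicP m1) (monicP m2).
  by rewrite !lead_coefE size_polyXn size_exp_XsubC /= => -> ->; rewrite subrr.
by rewrite coefB !nth_default ?subrr // ?size_polyXn ?(size_exp_XsubC q 1).
Qed.

Lemma deriv_power_gap : H^`() = q%:R *: ('X^(2 * g) - ('X - 1) ^+ (2 * g)).
Proof.
rewrite /power_gap derivB derivXn deriv_exp derivB derivX -[1]polyC1 derivC subr0 mul1r.
by rewrite addn1 /= -mulrnBl scaler_nat.
Qed.

(** The operator q - (X - 1) d/dX kills (X - 1)^q, which leaves a monomial. *)
Lemma euler_power_gap : q%:R *: H - ('X - 1) * H^`() = q%:R *: 'X^(2 * g).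
Proof.
rewrite deriv_power_gap -scalerAr -scalerBr; congr (_ *: _).
by rewrite /power_gap addn1 !exprS; ring.
Qed.

(* Compare the coefficients of X^(2g) in q H - (X - 1) H' = q X^(2g). *)
Lemma power_gap_lead : H`_(2 * g) = q%:R.
Proof.
have /(congr1 (fun p : {poly K} => p`_(2 * g))) := euler_power_gap.
have -> (p r : {poly K}) : (q%:R *: p - ('X - 1) * r)`_(2 * g) =
    q%:R * p`_(2 * g) - ((if (2 * g == 0)%N then 0 else r`_(2 * g).-1) - r`_(2 * g)).
  by rewrite coefB coefZ mulrBl mul1r coefB coefXM.
rewrite !coef_deriv coefZ coefXn eqxx mulr1.
have -> : H`_(2 * g).+1 = 0 by rewrite nth_default // -addn1 size_power_gap.
have -> : (2 * g == 0)%N = false by lia.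
rewrite mul0rn subr0 prednK ?muln_gt0 ?(ltnW g1) // => <-.
by rewrite natrD -mulr_natl; ring.
Qed.

Lemma power_gapE : H = q%:R *: U [set: _].
Proof.
have [||c HE] := @scale_root_prod [set: _] H.
- by rewrite cardsT card_ord -addn1 size_power_gap.
- by move=> i _; apply: rho_root.
rewrite {1}HE; congr (_ *: _); rewrite -power_gap_lead HE coefZ.
by have := root_prod_lead [set: _]; rewrite cardsT card_ord => ->; rewrite mulr1.
Qed.

Lemma root_prod_at0 I : (U I).[0] * (U (~: I)).[0] = q%:R^-1.
Proof.
rewrite -hornerM root_prod_setC; apply: (mulfI q0).
by rewrite mulfV // -hornerZ -power_gapE power_gap_at0.
Qed.

Lemma cardC_half I : #|I| = g -> #|~: I| = g.
Proof. by move=> Ig; have := cardsC I; rewrite card_ord; lia. Qed.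

Lemma root_prod_indep I c c' : #|I| = g ->
  c *: U (~: I) + c' *: U I = 0 -> c = 0 /\ c' = 0.
Proof.
move=> Ig e.
have nz (J : {set 'I_(2 * g)}) : #|J| = g -> exists i, i \in J.
  by move=> Jg; apply/set0Pn; rewrite -card_gt0 Jg ltnW.
have [i iI] := nz I Ig; have [j jI] := nz _ (cardC_half Ig).
have ev k : c * (U (~: I)).[rho k] + c' * (U I).[rho k] = 0.
  by rewrite -!hornerZ -hornerD e horner0.
have e0 J k : ((U J).[rho k] == 0) = (k \in J) by rewrite -root_root_prod.
split.
  have := ev i; have -> : (U I).[rho i] = 0 by apply/eqP; rewrite e0.
  by move/eqP; rewrite mulr0 addr0 mulf_eq0 e0 inE iI orbF => /eqP.
have := ev j; have -> : (U (~: I)).[rho j] = 0 by apply/eqP; rewrite e0.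
by move/eqP; rewrite mulr0 add0r mulf_eq0 e0; move: jI; rewrite inE => /negbTE ->; rewrite orbF => /eqP.
Qed.

(* H has 2g simple roots, so each of the two factors of v2^2 - v1^2 = c H
   vanishes at exactly g of them. *)
Lemma square_gap_split c v1 v2 : c != 0 ->
  (size v1 <= g.+1)%N -> (size v2 <= g.+1)%N -> v2 ^+ 2 - v1 ^+ 2 = c *: H ->
  exists I a b, [/\ #|I| = g, v1 = a *: U (~: I) + b *: U I &
    a * b = - (c * q%:R / 4%:R)].
Proof.
move=> c0 s1 s2 e; pose A := v2 - v1; pose B := v2 + v1.
have AB : A * B = c *: H by rewrite -e /A /B; ring.
have sA : (size A <= g.+1)%N.
  by rewrite (leq_trans (size_polyD _ _)) // size_polyN geq_max s1 s2.
have sB : (size B <= g.+1)%N by rewrite (leq_trans (size_polyD _ _)) // geq_max s1 s2.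
have AB0 : (A * B).[0] != 0 by rewrite AB hornerZ power_gap_at0 mulr1.
have A0 : A != 0 by apply: contraNneq AB0 => ->; rewrite mul0r horner0.
have B0 : B != 0 by apply: contraNneq AB0 => ->; rewrite mulr0 horner0.
pose I := [set i | root A (rho i)].
have rA i : i \in I -> root A (rho i) by rewrite inE.
have rB i : i \in ~: I -> root B (rho i).
  rewrite !inE => nA; have : root (A * B) (rho i) by rewrite AB rootZ.
  by rewrite rootM (negbTE nA).
have card_le p (J : {set 'I_(2 * g)}) : p != 0 -> (size p <= g.+1)%N ->
    (forall i, i \in J -> root p (rho i)) -> (#|J| <= g)%N.
  move=> p0 sp pJ; have : (size [seq rho i | i <- enum J] < size p)%N.
    apply: max_poly_roots => //; last by rewrite map_inj_uniq ?enum_uniq.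
    by apply/allP => _ /mapP[i + ->]; rewrite mem_enum; apply: pJ.
  by rewrite size_map -cardE => /leq_trans/(_ sp).
have Ig : #|I| = g.
  have := cardsC I; rewrite card_ord.
  move: (card_le _ _ A0 sA rA) (card_le _ _ B0 sB rB).
  by move: #|I| #|~: I| => n k; clear; lia.
have [|a AE] := @scale_root_prod I A _ rA; first by rewrite Ig.
have [|b BE] := @scale_root_prod (~: I) B _ rB; first by rewrite cardC_half.
have ab : a * b = c * q%:R.
  have := congr1 (horner^~ 0) AB; rewrite AE BE hornerM !hornerZ power_gap_at0 mulr1 => <-.
  have -> : a * (U I).[0] * (b * (U (~: I)).[0]) = a * b * ((U I).[0] * (U (~: I)).[0]) by ring.
  by rewrite root_prod_at0 divfK.
have four : 4%:R != 0 :> K by rewrite (natrM _ 2 2) mulf_neq0.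
(* v1 is half of B - A, where A = a U_I and B = b U_{~I}; the product of the new coefficients is - a
   b / 4. *)
exists I, (b / 2%:R), (- (a / 2%:R)); split=> //.
  have <- : 2%:R^-1 *: (B - A) = v1.
    rewrite /A /B (_ : _ - _ = 2%:R *: v1); first by rewrite scalerA mulVf // scale1r.
    by rewrite scaler_nat; ring.
  by rewrite AE BE scalerBr !scalerA scaleNr ![2%:R^-1 * _]mulrC.
by rewrite -ab; field; rewrite two four.
Qed.

(* If R^2 = H + d X^(2g) then R divides H + d X^(2g), its derivative, hence the
   linear polynomial (d + q) X + 2 g d. *)
Lemma power_gap_not_square d (R : {poly K}) : H + d *: 'X^(2 * g) != R ^+ 2.
Proof.
apply/eqP => e; pose G := H + d *: 'X^(2 * g).
pose L : {poly K} := (d + q%:R) *: 'X + (d * (2 * g)%:R)%:P.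
have gE : (2 * g)%N = (2 * g).-1.+1 by rewrite prednK // muln_gt0 (ltnW g1).
have E : q%:R *: G - ('X - 1) * G^`() = 'X^((2 * g).-1) * L.
  have -> : q%:R *: G - ('X - 1) * G^`() =
    q%:R *: 'X^(2 * g) + d *: (q%:R *: 'X^(2 * g) - ('X - 1) * ('X^(2 * g))^`()).
    rewrite -[X in _ = X + _]euler_power_gap /G derivD derivZ -!mul_polyC; ring.
  have -> : ('X^(2 * g))^`() = (2 * g)%:R *: 'X^((2 * g).-1) :> {poly K}.
    by rewrite derivXn scaler_nat.
  have -> : 'X^(2 * g) = 'X * 'X^((2 * g).-1) :> {poly K} by rewrite -exprS -gE.
  by rewrite /L natrD -!mul_polyC !(polyCD, polyCM); ring.
have RG' : R %| G^`() by rewrite /G e expr2 derivM dvdp_add ?dvdp_mulIl ?dvdp_mulIr.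
have RL : R %| 'X^((2 * g).-1) * L.
  by rewrite -E dvdp_sub ?(dvdp_mull _ RG') // dvdpZr // /G e expr2 dvdp_mulIl.
have R0 : R.[0] ^+ 2 = 1.
  by rewrite -horner_exp -e hornerD power_gap_at0 hornerZ hornerXn gE expr0n mulr0 addr0.
have R1 : R.[1] ^+ 2 = 1 + d.
  by rewrite -horner_exp -e hornerD power_gap_at1 hornerZ hornerXn expr1n mulr1.
have {}RL : R %| L.
  move: RL; rewrite Gauss_dvdpr // coprimep_expr // coprimepX.
  by apply: contra_eqN R0 => /rootP->; rewrite expr0n eq_sym oner_eq0.
(* L = 0 means d = -q and 2g = 0 in [K], so d = -1 and R(1)^2 = 1 + d = 0; but then G'(1) = 0,
   whereas it equals q. *)
have [L0|L0] := eqVneq L 0.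
  have d1 : d = - q%:R.
    have := congr1 (fun p : {poly K} => p`_1) L0.
    by rewrite /L coefD coefZ coefX coefC mulr1 addr0 coef0 => /eqP; rewrite addr_eq0 => /eqP.
  have d2 : d * (2 * g)%:R = 0.
    have := congr1 (fun p : {poly K} => p`_0) L0.
    by rewrite /L coefD coefZ coefX coefC mulr0 add0r coef0.
  have d3 : d = - 1.
    have g0 : (2 * g)%:R = 0 :> K.
      by apply: (mulfI q0); apply: oppr_inj; rewrite mulr0 -mulNr -d1 d2 oppr0.
    by rewrite d1 natrD g0 add0r.
  have R10 : R.[1] = 0 by apply/eqP; rewrite -sqrf_eq0 R1 d3 subrr.
  have : G^`().[1] = 0.
    by rewrite /G e expr2 derivM hornerD !hornerM R10 mul0r mulr0 addr0.
  rewrite /G derivD deriv_power_gap derivZ derivXn hornerD !hornerZ hornerD hornerN.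
  rewrite !hornerE hornerMn hornerXn subrr expr0n !expr1n.
  have -> : (2 * g == 0)%N = false by rewrite gE.
  by rewrite d2 addr0 subr0 mulr1 => /eqP; rewrite (negbTE q0).
(* Now deg R <= 1, so G has degree at most 2 < 2g and d = -q. This makes L, and with it R, constant,
   against R(0)^2 = 1 and R(1)^2 = 1 - q. *)
have sL : (size L <= 2)%N.
  rewrite (leq_trans (size_polyD _ _)) // geq_max (leq_trans (size_scale_leq _ _)) ?size_polyX //.
  by rewrite (leq_trans (size_polyC_leq1 _)).
have sR : (size R <= 2)%N := leq_trans (dvdp_leq L0 RL) sL.
have sG : (size G <= 3)%N.
  rewrite /G e expr2 (leq_trans (size_polyMleq _ _)) //.
  by move: sR; case: (size R) => [|[|[|]]].
have dq : d = - q%:R.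
  have : G`_(2 * g) = 0 by rewrite nth_default // (leq_trans sG) //; lia.
  rewrite /G coefD power_gap_lead coefZ coefXn eqxx mulr1 => /eqP.
  by rewrite addrC addr_eq0 => /eqP.
have sL1 : (size L <= 1)%N.
  by rewrite /L dq addNr scale0r add0r size_polyC_leq1.
have /size1_polyC RE : (size R <= 1)%N := leq_trans (dvdp_leq L0 RL) sL1.
have : R.[1] = R.[0] by rewrite RE !hornerC.
move=> R10; move: R1; rewrite R10 R0 => /eqP.
by rewrite -subr_eq0 opprD addNKr oppr_eq0 dq oppr_eq0 (negbTE q0).
Qed.

Lemma coef_half I : #|I| = g -> (U I)`_g = 1.
Proof. by move=> <-; apply: root_prod_lead. Qed.

(** If all these minors vanished, w'_0 w - w_0 w' would be a multiple of X^g. The square of w'_0 w +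
    w_0 w' differs from the square of that polynomial by 4 w_0 w'_0 w w', a nonzero multiple of H,
    so some H + d X^(2g) would be a square. *)
Lemma nonzero_minor J : #|J| = g -> exists2 j, (0 < j < g)%N &
  (U (~: J))`_0 * (U J)`_j - (U J)`_0 * (U (~: J))`_j != 0.
Proof.
move=> Jg; have Jg' := cardC_half Jg.
set w := U (~: J); set w' := U J; apply: contrapT => nj.
have mz j : (j < g)%N -> w`_0 * w'`_j = w'`_0 * w`_j.
  case: j => [|j] jg; first by rewrite mulrC.
  by apply/eqP; rewrite -subr_eq0; apply: contrapT => /negP nz; apply: nj; exists j.+1.
have w0w'0 : w`_0 * w'`_0 = q%:R^-1.
  by rewrite -!horner_coef0 mulrC root_prod_at0.
have e : w'`_0 *: w - w`_0 *: w' = (w'`_0 - w`_0) *: 'X^g.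
  apply/polyP => j; rewrite coefB !coefZ coefXn.
  have [jg|gj|->] := ltngtP j g.
  - by rewrite mulr0 mz // subrr.
  - have wj : w`_j = 0 by rewrite nth_default // size_root_prod Jg'.
    have w'j : w'`_j = 0 by rewrite nth_default // size_root_prod Jg.
    by rewrite wj w'j !mulr0 subrr.
  - by rewrite !coef_half // !mulr1.
pose W := w'`_0 *: w + w`_0 *: w'.
have WE : W ^+ 2 = (w'`_0 - w`_0) ^+ 2 *: 'X^(2 * g) + (4%:R * q%:R^-1 ^+ 2) *: H.
  have -> : W ^+ 2 = (w'`_0 *: w - w`_0 *: w') ^+ 2 + (4%:R * (w`_0 * w'`_0)) *: (w * w').
    by rewrite /W -!mul_polyC !polyCM polyC_natr; ring.
  rewrite e exprZn -exprM [(g * 2)%N]mulnC w0w'0 [w * w']mulrC root_prod_setC.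
  congr (_ + _); rewrite power_gapE scalerA; congr (_ *: _).
  by rewrite expr2 -!mulrA mulVf // mulr1.
have four : 4%:R != 0 :> K by rewrite (natrM _ 2 2) mulf_neq0.
have /negP := power_gap_not_square (q%:R ^+ 2 / 4%:R * (w'`_0 - w`_0) ^+ 2) ((q%:R / 2%:R) *: W).
apply; apply/eqP; rewrite exprZn WE scalerDr !scalerA addrC.
have half_sq (t : K) : t ^+ 2 / 4%:R = (t / 2%:R) ^+ 2.
  by field; rewrite two four.
have unit_sq (t : K) : t != 0 -> (t / 2%:R) ^+ 2 * (4%:R * t^-1 ^+ 2) = 1.
  by move=> t0; field; rewrite t0 two.
by rewrite half_sq unit_sq // scale1r.
Qed.

(* Given V = al U_{~I} + be U_I with V(aX) = al' U_{~J} + be' U_J, Cramer's rule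
   applied to the coefficients of degrees g, 0, j determines
   (al : be : al' : be'); al' be' = a^q al be then becomes an equation in a. *)
Section Elimination.
Variables (I J : {set 'I_(2 * g)}) (j : nat).
Hypothesis jg : (j < g)%N.
Local Notation u := (U (~: I)).
Local Notation u' := (U I).
Local Notation w := (U (~: J)).
Local Notation w' := (U J).
Hypothesis minor0 : w`_0 * w'`_j - w'`_0 * w`_j != 0.

(** The determinant, as a polynomial in a, of the coefficients of degrees g, 0, j of z(aX), w and
    w'; those of degree g are 1 before the substitution. *)
Definition elim_S (z : {poly K}) : {poly K} :=
  (w`_0 * w'`_j - w'`_0 * w`_j) *: 'X^g +
  ((- (z`_0 * (w'`_j - w`_j)))%:P + (z`_j * (w'`_0 - w`_0)) *: 'X^j).

(** The same determinant for z, u(aX) and u'(aX). *)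
Definition elim_T (z : {poly K}) : {poly K} :=
  (u`_0 * u'`_j - u'`_0 * u`_j) *: 'X^j +
  ((- (z`_0 * (u'`_j - u`_j))) *: 'X^(g + j) + (z`_j * (u'`_0 - u`_0)) *: 'X^g).

(** Cramer's rule makes (al, be, al', be') proportional to (S_u', - S_u, - T_w', T_w), with S for
    [elim_S] and T for [elim_T]; this is the condition al' be' = a^q al be up to sign. *)
Definition eliminant : {poly K} := 'X^q * (elim_S u * elim_S u') - elim_T w * elim_T w'.

Lemma coef_comp_scaleX p a k : (p \Po (a *: 'X))`_k = a ^+ k * p`_k.
Proof.
elim/poly_ind: p k => [|p c IH] k; first by rewrite comp_poly0 !coef0 mulr0.
rewrite comp_poly_MXaddC -scalerAr !(coefD, coefZ, coefMX, coefC).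
by case: k => [|k] /=; rewrite ?mulr0 ?add0r ?expr0 ?mul1r // !addr0 IH exprS mulrA.
Qed.

Lemma size_scaleXn c n k : (n < k)%N -> (size (c *: 'X^n : {poly K}) <= k)%N.
Proof. by move=> nk; rewrite (leq_trans (size_scale_leq _ _)) // size_polyXn. Qed.

Lemma size_elim_S z : size (elim_S z) = g.+1.
Proof.
rewrite /elim_S size_polyDl ?size_scale ?size_polyXn //.
rewrite ltnS (leq_trans (size_polyD _ _)) // geq_max size_scaleXn // andbT.
by rewrite (leq_trans (size_polyC_leq1 _)) // ltnW.
Qed.

Lemma size_elim_T z : (size (elim_T z) <= 2 * g)%N.
Proof.
rewrite (leq_trans (size_polyD _ _)) // geq_max size_scaleXn; last by lia.
rewrite (leq_trans (size_polyD _ _)) // geq_max !size_scaleXn //; lia.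
Qed.

(** Each [elim_S] has degree g with the nonzero minor as leading coefficient, so the first term has
    degree q + 2g = 4g + 1. Since j < g, each [elim_T] has degree below 2g, and their product is too
    small to interfere. *)
Lemma size_eliminant : size eliminant = (4 * g + 2)%N.
Proof.
have S0 z : elim_S z != 0 by rewrite -size_poly_gt0 size_elim_S.
have sS : size ('X^q * (elim_S u * elim_S u')) = (4 * g + 2)%N.
  by rewrite size_monicM ?monicXn ?mulf_neq0 // size_polyXn size_mul // !size_elim_S; lia.
rewrite /eliminant size_polyDl // size_polyN sS.
rewrite (leq_ltn_trans (size_polyMleq _ _)) //.
by move: (size_elim_T w) (size_elim_T w'); move: (size _) (size _) => n k; lia.
Qed.

Hypotheses (Ig : #|I| = g) (Jg : #|J| = g).

Lemma eliminant_root a al be al' be' lam : al != 0 ->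
  al * be = lam -> al' * be' = a ^+ q * lam ->
  (al *: u + be *: u') \Po (a *: 'X) = al' *: w + be' *: w' -> root eliminant a.
Proof.
move=> al0 ab ab' e.
have E k : a ^+ k * (al * u`_k + be * u'`_k) = al' * w`_k + be' * w'`_k.
  have := congr1 (fun p : {poly K} => p`_k) e.
  by rewrite coef_comp_scaleX !(coefD, coefZ).
have [ug u'g wg w'g] : [/\ u`_g = 1, u'`_g = 1, w`_g = 1 & w'`_g = 1].
  by rewrite !coef_half ?cardC_half.
have := E 0%N; have := E j; have := E g; rewrite ug u'g wg w'g !mulr1 expr0 mul1r => Eg Ej E0.
have hS z : (elim_S z).[a] = (w`_0 * w'`_j - w'`_0 * w`_j) * a ^+ g -
    z`_0 * (w'`_j - w`_j) + z`_j * (w'`_0 - w`_0) * a ^+ j.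
  by rewrite /elim_S !hornerD !hornerZ !hornerXn hornerC; ring.
have hT z : (elim_T z).[a] = (u`_0 * u'`_j - u'`_0 * u`_j) * a ^+ j -
    z`_0 * (u'`_j - u`_j) * (a ^+ g * a ^+ j) + z`_j * (u'`_0 - u`_0) * a ^+ g.
  by rewrite /elim_T !hornerD !hornerZ !hornerXn exprD; ring.
have rS : al * (elim_S u).[a] = - (be * (elim_S u').[a]).
  apply/eqP; rewrite -addr_eq0 !hS.
  have -> : al * ((w`_0 * w'`_j - w'`_0 * w`_j) * a ^+ g -
      u`_0 * (w'`_j - w`_j) + u`_j * (w'`_0 - w`_0) * a ^+ j) +
    be * ((w`_0 * w'`_j - w'`_0 * w`_j) * a ^+ g -
      u'`_0 * (w'`_j - w`_j) + u'`_j * (w'`_0 - w`_0) * a ^+ j) =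
    (w`_0 * w'`_j - w'`_0 * w`_j) * (a ^+ g * (al + be))
    - (w'`_j - w`_j) * (al * u`_0 + be * u'`_0)
    + (w'`_0 - w`_0) * (a ^+ j * (al * u`_j + be * u'`_j)) by ring.
  by rewrite Eg Ej E0; apply/eqP; ring.
have rT z : al * (elim_T z).[a] =
    (al * u`_0 + be * u'`_0) * (a ^+ j * u'`_j) - u'`_0 * (a ^+ j * (al * u`_j + be * u'`_j))
    - z`_0 * ((a ^+ g * (al + be)) * (a ^+ j * u'`_j) - a ^+ g * (a ^+ j * (al * u`_j + be * u'`_j)))
    + z`_j * ((a ^+ g * (al + be)) * u'`_0 - a ^+ g * (al * u`_0 + be * u'`_0)).
  by rewrite hT; ring.
have rT1 : al * (elim_T w').[a] = - (al' * (elim_S u').[a]).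
  by rewrite rT Eg Ej E0 hS; ring.
have rT2 : al * (elim_T w).[a] = be' * (elim_S u').[a].
  by rewrite rT Eg Ej E0 hS; ring.
(* Multiplied by al^2, the eliminant at a becomes (al' be' - a^q al be) S_u'(a)^2; no division by
   S_u'(a), which may be zero, is made. *)
apply/eqP; apply: (mulfI (mulf_neq0 al0 al0)); rewrite mulr0 /eliminant.
have -> (p1 p2 p3 p4 : {poly K}) : ('X^q * (p1 * p2) - p3 * p4).[a] =
    a ^+ q * (p1.[a] * p2.[a]) - p3.[a] * p4.[a].
  by rewrite !(hornerD, hornerN, hornerM) hornerXn.
have -> : al * al * (a ^+ q * ((elim_S u).[a] * (elim_S u').[a]) -
    (elim_T w).[a] * (elim_T w').[a]) =
  a ^+ q * ((al * (elim_S u).[a]) * (al * (elim_S u').[a])) -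
   (al * (elim_T w).[a]) * (al * (elim_T w').[a]) by ring.
rewrite rS rT1 rT2; have -> : a ^+ q * (- (be * (elim_S u').[a]) * (al * (elim_S u').[a])) -
    be' * (elim_S u').[a] * - (al' * (elim_S u').[a]) =
   (al' * be' - a ^+ q * (al * be)) * (elim_S u').[a] ^+ 2 by ring.
by rewrite ab ab' subrr mul0r.
Qed.
End Elimination.

Definition on_pencil I lam v := exists al be, [/\ v = al *: U (~: I) + be *: U I & al * be = lam].

(** No dilation except the identity carries one half of the roots to another half; [unity_circle]
    proves this for the roots 1 / (1 - e). *)
Hypothesis circle : forall I J a c, #|I| = g -> #|J| = g -> a != 0 ->
  U I \Po (a *: 'X) = c *: U J -> a = 1.

Lemma on_pencil_sqr I lam al be al' be' : lam != 0 -> al * be = lam -> al' * be' = lam ->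
  al ^+ 2 = al' ^+ 2 ->
  (al *: U (~: I) + be *: U I) ^+ 2 = (al' *: U (~: I) + be' *: U I) ^+ 2.
Proof.
move=> lam0 e e' /eqP; rewrite eqf_sqr.
have al0 : al != 0 by apply: contraNneq lam0 => al0; rewrite -e al0 mul0r.
move=> /orP[/eqP|/eqP] aa.
  have /(mulfI al0) -> : al * be = al * be' by rewrite e aa e'.
  by rewrite aa.
have -> : be = - be' by apply: (mulfI al0); rewrite e -e' aa mulrNN.
by rewrite aa !scaleNr -opprD sqrrN.
Qed.

(* Three pairwise independent members of both pencils would force the two
   quadratic forms al be and al' be' to be proportional. *)
Lemma on_pencils_at_most2 I J a lam v1 v2 v3 : #|I| = g -> #|J| = g ->
  a != 0 -> a != 1 -> lam != 0 ->
  (forall v, v \in [:: v1; v2; v3] -> on_pencil I lam v /\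
     on_pencil J (a ^+ q * lam) (v \Po (a *: 'X))) ->
  [\/ v1 ^+ 2 = v2 ^+ 2, v1 ^+ 2 = v3 ^+ 2 | v2 ^+ 2 = v3 ^+ 2].
Proof.
move=> Ig Jg a0 a1 lam0 H3.
have in1 : v1 \in [:: v1; v2; v3] by rewrite !inE eqxx.
have in2 : v2 \in [:: v1; v2; v3] by rewrite !inE eqxx orbT.
have in3 : v3 \in [:: v1; v2; v3] by rewrite !inE eqxx !orbT.
have [[x1 [y1 [V1 L1]]] [x1' [y1' [V1' L1']]]] := H3 v1 in1.
have [[x2 [y2 [V2 L2]]] [x2' [y2' [V2' L2']]]] := H3 v2 in2.
have [[x3 [y3 [V3 L3]]] [x3' [y3' [V3' L3']]]] := H3 v3 in3.
have alam0 : a ^+ q * lam != 0 by rewrite mulf_neq0 ?expf_neq0.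
have nz (l x y : K) : l != 0 -> x * y = l -> x != 0 /\ y != 0.
  by move=> l0 e; split; apply: contraNneq l0 => z; rewrite -e z ?mul0r ?mulr0.
have [x10 y10] := nz _ _ _ lam0 L1; have [x20 y20] := nz _ _ _ lam0 L2.
have [x10' y10'] := nz _ _ _ alam0 L1'; have [x20' y20'] := nz _ _ _ alam0 L2'.
have [e12|n12] := eqVneq (x1 ^+ 2) (x2 ^+ 2).
  by apply: Or31; rewrite V1 V2; exact: (on_pencil_sqr I lam0 L1 L2 e12).
have Y1 : y1 = lam / x1 by rewrite -L1; field.
have Y2 : y2 = lam / x2 by rewrite -L2; field.
pose D := x1 * y2 - x2 * y1.
have D0 : D != 0.
  have -> : D = lam * (x1 ^+ 2 - x2 ^+ 2) / (x1 * x2) by rewrite /D Y1 Y2; field; apply/andP.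
  by rewrite mulf_neq0 ?invr_eq0 ?mulf_neq0 ?subr_eq0.
pose p := (x3 * y2 - x2 * y3) / D; pose r := (x1 * y3 - x3 * y1) / D.
have pD : p * D = x3 * y2 - x2 * y3 by rewrite divfK.
have rD : r * D = x1 * y3 - x3 * y1 by rewrite divfK.
have X3 : x3 = p * x1 + r * x2.
  apply: (mulIf D0); transitivity (p * D * x1 + r * D * x2); last by ring.
  by rewrite pD rD /D; ring.
have Y3 : y3 = p * y1 + r * y2.
  apply: (mulIf D0); transitivity (p * D * y1 + r * D * y2); last by ring.
  by rewrite pD rD /D; ring.
clearbody p r.
have V3E : v3 = p *: v1 + r *: v2.
  by rewrite V3 V1 V2 {1}X3 {1}Y3 -!mul_polyC !(polyCD, polyCM); ring.
have [X3' Y3'] : x3' = p * x1' + r * x2' /\ y3' = p * y1' + r * y2'.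
  have e : (p * x1' + r * x2' - x3') *: U (~: J) + (p * y1' + r * y2' - y3') *: U J = 0.
    have := V3'; rewrite V3E comp_polyD !comp_polyZ V1' V2'.
    rewrite -!mul_polyC !(polyCB, polyCD, polyCM) => e3; apply/eqP.
    rewrite -subr_eq0 subr0; move/eqP: e3; rewrite -subr_eq0.
    by congr (_ == 0); ring.
  by have [/eqP + /eqP] := root_prod_indep Jg e; rewrite !subr_eq0 => /eqP<- /eqP<-.
pose S := x1 * y2 + x2 * y1; pose S' := x1' * y2' + x2' * y1'.
(* The product of the coefficients of v3 is expanded along v1 and v2 in both pencils; when p r is
   nonzero, comparison gives S' = a^q S. *)
have Q1 : lam = (p ^+ 2 + r ^+ 2) * lam + p * r * S.
  transitivity (p ^+ 2 * (x1 * y1) + r ^+ 2 * (x2 * y2) + p * r * S).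
    by rewrite -[LHS]L3 [in LHS]X3 [in LHS]Y3 /S; ring.
  by rewrite L1 L2; ring.
have Q2 : a ^+ q * lam = (p ^+ 2 + r ^+ 2) * (a ^+ q * lam) + p * r * S'.
  transitivity (p ^+ 2 * (x1' * y1') + r ^+ 2 * (x2' * y2') + p * r * S').
    by rewrite -[LHS]L3' X3' Y3' /S'; ring.
  by rewrite L1' L2'; ring.
have [p0|p0] := eqVneq p 0.
  have r1 : r ^+ 2 = 1.
    by apply: (mulIf lam0); rewrite mul1r [RHS]Q1 p0 !mul0r addr0 expr0n add0r.
  by apply: Or33; rewrite V3E p0 scale0r add0r exprZn r1 scale1r.
have [r0|r0] := eqVneq r 0.
  have p1 : p ^+ 2 = 1.
    by apply: (mulIf lam0); rewrite mul1r [RHS]Q1 r0 mulr0 mul0r addr0 expr0n addr0.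
  by apply: Or32; rewrite V3E r0 scale0r addr0 exprZn p1 scale1r.
exfalso.
have SS : a ^+ q * S = S'.
  have : p * r * (a ^+ q * S - S') = 0.
    have -> : p * r * (a ^+ q * S - S') = a ^+ q * ((p ^+ 2 + r ^+ 2) * lam + p * r * S)
       - ((p ^+ 2 + r ^+ 2) * (a ^+ q * lam) + p * r * S') by ring.
    by rewrite -Q1 -Q2 subrr.
  by move/eqP; rewrite !mulf_eq0 (negbTE p0) (negbTE r0) subr_eq0 => /eqP.
(* S' = a^q S says that t + 1/t is the same for t = x2 / x1 and for t = x2' / x1', so these ratios
   are equal or inverse. *)
have F : a ^+ q * lam * ((x1 * x2' - x1' * x2) * (x1 * x1' - x2 * x2')) = 0.
  have -> : a ^+ q * lam * ((x1 * x2' - x1' * x2) * (x1 * x1' - x2 * x2')) =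
     a ^+ q * (x1 ^+ 2 * lam + x2 ^+ 2 * lam) * (x1' * x2') -
     (x1' ^+ 2 * (a ^+ q * lam) + x2' ^+ 2 * (a ^+ q * lam)) * (x1 * x2) by ring.
  transitivity ((a ^+ q * S - S') * (x1 * x2 * x1' * x2')).
    transitivity (a ^+ q * (x1 ^+ 2 * (x2 * y2) + x2 ^+ 2 * (x1 * y1)) * (x1' * x2') -
      (x1' ^+ 2 * (x2' * y2') + x2' ^+ 2 * (x1' * y1')) * (x1 * x2)).
      by rewrite L1 L2 L1' L2'.
    by rewrite /S /S'; ring.
  by rewrite SS subrr mul0r.
(* This combination of v1 and v2 isolates U_{~I}. In either case one coefficient on the right
   vanishes, and [circle] gives a = 1. *)
have comb : D *: (U (~: I) \Po (a *: 'X)) =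
    (y2 * x1' - y1 * x2') *: U (~: J) + (y2 * y1' - y1 * y2') *: U J.
  have -> : D *: (U (~: I) \Po (a *: 'X)) = y2 *: (v1 \Po (a *: 'X)) - y1 *: (v2 \Po (a *: 'X)).
    rewrite -!comp_polyZ -comp_polyB V1 V2 /D -!mul_polyC !(polyCD, polyCN, polyCM).
    by congr (_ \Po _); ring.
  by rewrite V1' V2' -!mul_polyC !(polyCD, polyCN, polyCM); ring.
have x120 : x1 * x2 != 0 by rewrite mulf_neq0.
move/eqP: F; rewrite mulf_eq0 (negbTE alam0) /= mulf_eq0 !subr_eq0.
have Ig' := cardC_half Ig; have Jg' := cardC_half Jg.
have unscale c' (J' : {set 'I_(2 * g)}) : #|J'| = g ->
    D *: (U (~: I) \Po (a *: 'X)) = c' *: U J' -> False.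
  move=> Jg2 e; case/eqP: a1; apply: (@circle (~: I) J' a (c' / D)) => //.
  by rewrite mulrC -scalerA -e scalerA mulVf // scale1r.
case/orP => /eqP e.
  have yy : y2 * y1' = y1 * y2'.
    apply: (mulIf (mulf_neq0 x120 (mulf_neq0 x10' x20'))).
    transitivity ((x2 * y2) * (x1' * y1') * (x1 * x2')); first by ring.
    transitivity ((x1 * y1) * (x2' * y2') * (x1' * x2)); last by ring.
    by rewrite L1 L2 L1' L2' e.
  by apply: unscale Jg' _; rewrite comb yy subrr scale0r addr0.
have yx : y2 * x1' = y1 * x2'.
  apply: (mulIf x120).
  transitivity ((x2 * y2) * (x1 * x1')); first by ring.
  transitivity ((x1 * y1) * (x2 * x2')); last by ring.
  by rewrite L1 L2 e.
by apply: unscale Jg _; rewrite comb yx subrr scale0r add0r.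
Qed.

Local Notation lam := (- (q%:R / 4%:R) : K).

Lemma cover_pencil_pair I J : #|I| = g -> #|J| = g ->
  exists2 s : seq {poly K}, (size s <= 2 * (4 * g + 1))%N &
  forall w : {poly K}, (exists v a, [/\ a != 0, a != 1, on_pencil I lam v,
    on_pencil J (a ^+ q * lam) (v \Po (a *: 'X)) & w = v ^+ 2]) -> w \in s.
Proof.
move=> Ig Jg; have four : 4%:R != 0 :> K by rewrite (natrM _ 2 2) mulf_neq0.
have lam0 : lam != 0 by rewrite oppr_eq0 mulf_neq0 ?invr_eq0.
have [j /andP[j0 jg] mj] := nonzero_minor Jg.
have sE := size_eliminant I jg mj.
have [r rE] := closed_field_poly_normal (eliminant I J j).
have E0 : eliminant I J j != 0 by rewrite -size_poly_gt0 sE addn2.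
have sr : size r = (4 * g + 1)%N.
  have := sE; rewrite rE size_scale ?lead_coef_eq0 // size_prod_XsubC; lia.
pose R a (w : {poly K}) := exists v, [/\ a != 0, a != 1, on_pencil I lam v,
    on_pencil J (a ^+ q * lam) (v \Po (a *: 'X)) & w = v ^+ 2].
have [a _|s ss sR] := @cover_seq _ _ R 2 r.
  apply: cover_at_most2 => _ _ _ [v1 [a0 a1 I1 J1 ->]] [v2 [_ _ I2 J2 ->]] [v3 [_ _ I3 J3 ->]].
  apply: (on_pencils_at_most2 Ig Jg a0 a1 lam0) => v.
  by rewrite !inE => /or3P[] /eqP->.
exists s; first by rewrite -sr.
move=> w [v [a [a0 a1 Iv Jv wE]]]; apply: (sR a); last by exists v.
have [al [be [vE L]]] := Iv; have [al' [be' [vE' L']]] := Jv.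
have al0 : al != 0 by apply: contraNneq lam0 => al0; rewrite -L al0 mul0r.
have := @eliminant_root I J j Ig Jg a al be al' be' lam al0 L L'.
rewrite -vE -vE' => /(_ erefl).
by rewrite rE rootZ ?lead_coef_eq0 // root_prod_XsubC.
Qed.

Lemma cover_three_abscissae : exists2 s : seq {poly K},
  (size s <= 2 * (4 * g + 1) * 'C(2 * g, g) ^ 2)%N &
  forall v1 v2 v3 a, (size v1 <= g.+1)%N -> (size v2 <= g.+1)%N ->
    (size v3 <= g.+1)%N -> a != 0 -> a != 1 ->
    'X^q + v1 ^+ 2 = ('X - 1) ^+ q + v2 ^+ 2 ->
    'X^q + v1 ^+ 2 = ('X - a%:P) ^+ q + v3 ^+ 2 -> 'X^q + v1 ^+ 2 \in s.
Proof.
pose D := [set I : {set 'I_(2 * g)} | #|I| == g].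
pose R (IJ : {set 'I_(2 * g)} * {set 'I_(2 * g)}) (f : {poly K}) :=
  exists v a, [/\ a != 0, a != 1, on_pencil IJ.1 lam v,
    on_pencil IJ.2 (a ^+ q * lam) (v \Po (a *: 'X)) & f - 'X^q = v ^+ 2].
have [[I J]|s ss sR] := @cover_seq _ _ R (2 * (4 * g + 1)) (enum (finset.setX D D)).
  rewrite mem_enum !inE /= => /andP[/eqP Ig /eqP Jg].
  have [s ss sR] := cover_pencil_pair Ig Jg.
  exists [seq 'X^q + w | w <- s]; first by rewrite size_map.
  move=> f fR; apply/mapP; exists (f - 'X^q); last by rewrite addrC subrK.
  by apply: sR; have [v [a [? ? ? ? ?]]] := fR; exists v, a.
exists s.
  rewrite (leq_trans ss) // leq_mul2l -cardE cardsX /D card_draws card_ord.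
  by rewrite expnS expn1 leqnn orbT.
move=> v1 v2 v3 a s1 s2 s3 a0 a1 e2 e3.
have swap (A B A' B' : {poly K}) : A + B = A' + B' -> B' - B = A - A'.
  by move=> e; rewrite -[B'](addKr A') -e; ring.
have gap2 : v2 ^+ 2 - v1 ^+ 2 = 1 *: H by rewrite scale1r; apply: swap.
have gap3 : (v3 \Po (a *: 'X)) ^+ 2 - (v1 \Po (a *: 'X)) ^+ 2 = (a ^+ q) *: H.
  have -> : (v3 \Po (a *: 'X)) ^+ 2 - (v1 \Po (a *: 'X)) ^+ 2 =
      ('X^q - ('X - a%:P) ^+ q) \Po (a *: 'X).
    by rewrite !expr2 -!comp_polyM -comp_polyB -!expr2; congr (_ \Po _); apply: swap.
  rewrite comp_polyB !rmorphXn /= comp_polyB comp_polyX comp_polyC /power_gap scalerBr.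
  have -> : a *: 'X - a%:P = a *: ('X - 1) by rewrite scalerBr alg_polyC.
  by rewrite !exprZn.
have sc v : (size v <= g.+1)%N -> (size (v \Po (a *: 'X)) <= g.+1)%N.
  by move=> sv; rewrite size_comp_poly2 // size_scale // size_polyX.
have [I [al [be [Ig vE L]]]] := square_gap_split (oner_neq0 K) s1 s2 gap2.
have [J [al' [be' [Jg vE' L']]]] :=
  square_gap_split (expf_neq0 q a0) (sc _ s1) (sc _ s3) gap3.
apply: (sR (I, J)); first by rewrite mem_enum !inE /= Ig Jg eqxx.
exists v1, a; split=> //=; last by rewrite addrC addKr.
  by exists al, be; rewrite L mul1r.
by exists al', be'; rewrite L' mulrN mulrA.
Qed.

End Pencil.

(** * Roots of unity *)

Section UnityRigidity.
Local Open Scope ring_scope.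

(* The points 1 - e, for e^q = 1, lie on a circle through 0, and two distinct
   circles through 0 meet in at most one other point. *)
Definition unity_rigid (K : fieldType) (q : nat) : Prop :=
  forall e1 e2 d1 d2 : K, e1 ^+ q = 1 -> e2 ^+ q = 1 -> d1 ^+ q = 1 -> d2 ^+ q = 1 ->
  e1 != 1 -> d2 != 1 -> e1 != e2 ->
  (1 - e1) * (1 - d2) = (1 - e2) * (1 - d1) -> e2 = d2.

(** Comparing the relation with the one for inverses gives e1 d2 = e2 d1, and then e1 + d2 = e2 +
    d1. Equal sum and product mean that e2 is e1 or d2. *)
Lemma unity_rigid_conj (K : fieldType) (q : nat) : (0 < q)%N ->
  (forall e1 e2 d1 d2 : K, e1 ^+ q = 1 -> e2 ^+ q = 1 -> d1 ^+ q = 1 -> d2 ^+ q = 1 ->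
    (1 - e1) * (1 - d2) = (1 - e2) * (1 - d1) ->
    (1 - e1^-1) * (1 - d2^-1) = (1 - e2^-1) * (1 - d1^-1)) ->
  unity_rigid K q.
Proof.
move=> q0 conj e1 e2 d1 d2 E1 E2 D1 D2 e11 d21 e12 rel.
have nz (z : K) : z ^+ q = 1 -> z != 0.
  by move=> zq; apply: contra_eqN zq => /eqP->; rewrite expr0n gtn_eqF // eq_sym oner_eq0.
have [e10 e20 d10 d20] := And4 (nz _ E1) (nz _ E2) (nz _ D1) (nz _ D2).
have crel := conj _ _ _ _ E1 E2 D1 D2 rel.
have l0 : (1 - e1) * (1 - d2) != 0 by rewrite mulf_neq0 // subr_eq0 eq_sym.
have prod : e2 * d1 = e1 * d2.
  apply: (mulfI l0).
  transitivity ((1 - e1^-1) * (1 - d2^-1) * (e1 * e2 * d1 * d2)).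
    by field; rewrite e10 d20.
  by rewrite crel rel; field; rewrite e20 d10.
have sum : e1 + d2 = e2 + d1.
  have : (1 - e1) * (1 - d2) - e1 * d2 = (1 - e2) * (1 - d1) - e2 * d1 by rewrite rel prod.
  move=> e; apply: oppr_inj; apply: (addrI 1); transitivity ((1 - e1) * (1 - d2) - e1 * d2).
    by ring.
  by rewrite e; ring.
have : (e1 - e2) * (e2 - d2) = 0.
  have -> : (e1 - e2) * (e2 - d2) = e2 * (e1 + d2 - e2) - e1 * d2 by ring.
  by rewrite sum -prod; ring.
by move/eqP; rewrite mulf_eq0 !subr_eq0 (negbTE e12) => /eqP.
Qed.

Lemma unity_rigid_algC q : (0 < q)%N -> unity_rigid algC q.
Proof.
move=> q0; apply: unity_rigid_conj => // e1 e2 d1 d2 E1 E2 D1 D2 /(congr1 (fun z => z^*)).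
have inv (z : algC) : z ^+ q = 1 -> z^* = z^-1.
  move=> zq; have z0 : z != 0.
    by apply: contra_eqN zq => /eqP->; rewrite expr0n gtn_eqF // eq_sym oner_eq0.
  have : `|z| = 1 by apply/eqP; rewrite -(@pexpr_eq1 _ _ q) // -normrX zq normr1.
  by move=> z1; apply: (mulfI z0); rewrite mulfV // -normCK z1 expr1n.
by rewrite !rmorphM !rmorphB !rmorph1 /= !inv.
Qed.

(** Raising to the power p^k is a ring endomorphism, and it inverts q-th roots of unity because p^k
    = -1 mod q. *)
Lemma Frobenius_power_rigid (K : fieldType) (q p k : nat) : (0 < q)%N ->
  p \in [pchar K] -> (p ^ k = q.-1 %[mod q])%N -> unity_rigid K q.
Proof.
move=> q0 pK pk; apply: unity_rigid_conj => // e1 e2 d1 d2 E1 E2 D1 D2.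
move=> /(congr1 (fun z => z ^+ (p ^ k))).
have pn : [pchar K].-nat (p ^ k)%N.
  by rewrite pnatX (eq_pnat _ (pcharf_eq pK)) pnat_id ?orTb ?(pcharf_prime pK).
have inv (z : K) : z ^+ q = 1 -> z ^+ (p ^ k) = z^-1.
  move=> zq; have z0 : z != 0.
    by apply: contra_eqN zq => /eqP->; rewrite expr0n gtn_eqF // eq_sym oner_eq0.
  apply: (mulfI z0); rewrite mulfV // -exprS (divn_eq (p ^ k) q) pk modn_small ?prednK //.
  by rewrite -addnS prednK // exprD mulnC exprM zq expr1n mul1r.
have sub (z : K) : z ^+ q = 1 -> (1 - z) ^+ (p ^ k) = 1 - z^-1.
  by move=> zq; rewrite exprDn_pchar // exprNn_pchar // expr1n inv.
by rewrite !exprMn !sub.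
Qed.

Lemma prim_root_exists (K : closedFieldType) q : q%:R != 0 :> K ->
  exists z : K, q.-primitive_root z.
Proof.
move=> qK; have q0 : (0 < q)%N by rewrite lt0n; apply: contraNneq qK => ->.
pose p : {poly K} := 'X^q - 1; have [r Dp] := closed_field_poly_normal p.
rewrite (monicP _) ?monicXnsubC // scale1r in Dp.
have rn1 : all q.-unity_root r by apply/allP=> z; rewrite -root_prod_XsubC -Dp.
have sz_r : (q < (size r).+1)%N by rewrite -(size_prod_XsubC r id) -Dp size_XnsubC.
have [|z] := hasP (has_prim_root q0 rn1 _ sz_r); last by exists z.
by rewrite -separable_prod_XsubC -Dp separable_Xn_sub_1.
Qed.

(** z is a root of Phi_d for some d dividing q, and then z^d = 1 forces d = q. *)
Lemma root_Cyclotomic_prim (K : fieldType) q (z : K) : q.-primitive_root z ->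
  root (map_poly intr 'Phi_q) z.
Proof.
move=> zP; have q0 := prim_order_gt0 zP.
have : root (map_poly intr (\prod_(d <- divisors q) 'Phi_d)) z.
  by rewrite prod_Cyclotomic // rmorphB rmorph1 /= map_polyXn rootE !hornerE (prim_expr_order zP) subrr.
rewrite rmorph_prod /root horner_prod prodf_seq_eq0 => /hasP[d dq /= zd].
suff /eqP <- : d == q by [].
rewrite -dvdn_divisors // in dq; rewrite eqn_dvd dq /= (prim_order_dvd zP).
have d0 := dvdn_gt0 q0 dq.
have /(congr1 (fun p => (map_poly (intr : int -> K) p).[z])) := prod_Cyclotomic d0.
rewrite rmorph_prod horner_prod rmorphB rmorph1 /= map_polyXn !hornerE.
rewrite (big_rem d) /=; last by rewrite -dvdn_divisors.
by rewrite (eqP zd) mul0r => /esym/eqP; rewrite subr_eq0.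
Qed.

(* A polynomial relation over Z satisfied by z in K also holds for some complex
   primitive q-th root of unity: otherwise its resultant with Phi_q would be a
   nonzero integer vanishing in K. *)
Lemma prim_root_transfer (K : fieldType) q (z : K) (h : {poly int}) :
  [pchar K] =i pred0 -> q.-primitive_root z -> root (map_poly intr h) z ->
  exists2 w : algC, q.-primitive_root w & root (map_poly intr h) w.
Proof.
move=> /pcharf0P K0 zP hz; have q0 := prim_order_gt0 zP.
have intr0 (n : int) : (n%:~R : K) = 0 -> n = 0.
  case: n => n /eqP; first by rewrite -[X in X == 0]/(n%:R) K0 => /eqP->.
  by rewrite -[X in X == 0]/(- n.+1%:R) oppr_eq0 K0.
have [w0 w0P] := C_prim_root_exists q0.
have [h1|h1] := leqP (size h) 1.
  exists w0 => //; move: hz; rewrite (size1_polyC h1) !map_polyC /= !rootC.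
  by move/eqP/intr0 => ->; rewrite rmorph0.
have sPhi : (1 < size 'Phi_q)%N by rewrite size_Cyclotomic ltnS totient_gt0.
have PhiC : map_poly intr 'Phi_q = cyclotomic w0 q := Cintr_Cyclotomic w0P.
have [r0|r0] := eqVneq (resultant h 'Phi_q) 0; last first.
  have [[u v] _ /=] := resultant_in_ideal h1 sPhi.
  move/(congr1 (fun p => (map_poly (intr : int -> K) p).[z])).
  rewrite map_polyC hornerC rmorphD !rmorphM hornerD !hornerM /=.
  rewrite (rootP hz) (rootP (root_Cyclotomic_prim zP)) !mulr0 addr0 => /intr0 r0'.
  by rewrite r0' eqxx in r0.
have sg : (1 < size (gcdp h 'Phi_q))%N by rewrite -resultant_eq0 r0.
have [w wg] : exists w : algC, root (map_poly intr (gcdp h 'Phi_q)) w.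
  apply/closed_rootP; rewrite size_map_inj_poly ?rmorph0 //; last exact: intr_inj.
  by rewrite gtn_eqF.
have inC (p : {poly int}) : gcdp h 'Phi_q %| p -> root (map_poly intr p) w.
  move=> /Pdiv.Idomain.dvdpP[[c r] /= c0 e].
  have := congr1 (fun p => (map_poly (intr : int -> algC) p).[w]) e.
  rewrite -mul_polyC !rmorphM !hornerM /= map_polyC hornerC (rootP wg) mulr0.
  by move/eqP; rewrite mulf_eq0 intr_eq0 (negbTE c0).
exists w; last exact/inC/dvdp_gcdl.
by rewrite -(root_cyclotomic w0P) -PhiC; apply/inC/dvdp_gcdr.
Qed.

(** In terms of exponents of z the relation is a polynomial identity over the integers, so it
    transfers to a complex w; equality of two powers depends only on the exponents mod q, so the
    inequalities and the conclusion transfer too. *)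
Lemma char0_rigid (K : closedFieldType) q : (0 < q)%N -> [pchar K] =i pred0 ->
  unity_rigid K q.
Proof.
move=> q0 K0; have qK : q%:R != 0 :> K by rewrite ((pcharf0P K).1 K0) -lt0n.
have [z zP] := prim_root_exists qK.
move=> a1 a2 b1 b2 /(prim_rootP zP)[i1 ->] /(prim_rootP zP)[i2 ->].
move=> /(prim_rootP zP)[j1 ->] /(prim_rootP zP)[j2 ->] e1 d2 e12 rel.
pose h : {poly int} := (1 - 'X^i1) * (1 - 'X^j2) - (1 - 'X^i2) * (1 - 'X^j1).
have hE (F : fieldType) (x : F) : (map_poly intr h).[x] =
   (1 - x ^+ i1) * (1 - x ^+ j2) - (1 - x ^+ i2) * (1 - x ^+ j1).
  by rewrite /h !(rmorphB, rmorphM, rmorph1) /= !map_polyXn !(hornerD, hornerN, hornerM, hornerC, hornerXn).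
have [|w wP wh] := prim_root_transfer (h := h) K0 zP.
  by rewrite rootE hE rel subrr.
have same (i j : nat) : (z ^+ i == z ^+ j) = (w ^+ i == w ^+ j).
  by rewrite (eq_prim_root_expr zP) (eq_prim_root_expr wP).
have wq (i : nat) : (w ^+ i) ^+ q = 1 by rewrite exprAC (prim_expr_order wP) expr1n.
apply/eqP; rewrite same; apply/eqP.
apply: (unity_rigid_algC q0 (wq i1) (wq i2) (wq j1) (wq j2)).
- by rewrite -(expr0 w) -same expr0.
- by rewrite -(expr0 w) -same expr0.
- by rewrite -same.
by apply/eqP; rewrite -subr_eq0 -hE.
Qed.

(** * The roots 1 / (1 - e) and their dilations *)

Section UnityRoots.
Variables (K : closedFieldType) (g : nat).
Hypotheses (g1 : (1 < g)%N).
Local Notation q := (2 * g + 1)%N.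
Variable z : K.
Hypotheses (zP : q.-primitive_root z) (rigid : unity_rigid K q).

(** The exponents 1, ..., 2g run through the q-th roots of unity other than 1. *)
Definition unity_rho (i : 'I_(2 * g)) : K := (1 - z ^+ i.+1)^-1.

Lemma unity_neq1 (i : 'I_(2 * g)) : z ^+ i.+1 != 1.
Proof.
by rewrite -(prim_order_dvd zP) gtnNdvd // addn1 ltnS.
Qed.

Lemma unity_sub_neq0 (i : 'I_(2 * g)) : 1 - z ^+ i.+1 != 0.
Proof. by rewrite subr_eq0 eq_sym unity_neq1. Qed.

Lemma unity_rho_inj : injective unity_rho.
Proof.
move=> i j /invr_inj/addrI/oppr_inj/eqP.
rewrite (eq_prim_root_expr zP) !modn_small ?addn1 ?ltnS // => /eqP[ij].
exact: val_inj.
Qed.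

Lemma unity_rho_root i : root (power_gap K g) (unity_rho i).
Proof.
rewrite /root /power_gap !hornerE subr_eq0.
have -> : unity_rho i - 1 = z ^+ i.+1 * unity_rho i.
  by rewrite /unity_rho; field; apply: unity_sub_neq0.
by rewrite exprMn exprAC (prim_expr_order zP) expr1n mul1r.
Qed.

(** Every e' indexed by J satisfies a (1 - e) = 1 - e' for some e. As g > 1 there are two such
    equations; eliminating a gives the relation of [unity_rigid], hence e = e' in one of them and a
    = 1. *)
Lemma unity_circle (I J : {set 'I_(2 * g)}) (a c : K) : #|I| = g -> #|J| = g ->
  a != 0 -> root_prod unity_rho I \Po (a *: 'X) = c *: root_prod unity_rho J -> a = 1.
Proof.
move=> Ig Jg a0 e.
have key j : j \in J -> exists i : 'I_(2 * g), a * (1 - z ^+ i.+1) = 1 - z ^+ j.+1.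
  move=> jJ; have : root (root_prod unity_rho I) (a * unity_rho j).
    have -> : a * unity_rho j = (a *: 'X).[unity_rho j] by rewrite hornerZ hornerX.
    rewrite /root -horner_comp e hornerZ.
    have := root_root_prod unity_rho_inj J j; rewrite jJ => /rootP->.
    by rewrite mulr0.
  case/root_root_prodP => i iI ai; exists i.
  apply: (mulIf (invr_neq0 (unity_sub_neq0 i))).
  rewrite mulfK ?unity_sub_neq0 // -/(unity_rho i) -ai mulrCA mulfV ?mulr1 //.
  exact: unity_sub_neq0.
have [j1 [j2 [j1J j2J j12]]] : exists j1 j2, [/\ j1 \in J, j2 \in J & j1 != j2].
  by have /card_gt1P[j1 [j2 [? ? ?]]] : (1 < #|J|)%N; [rewrite Jg | exists j1, j2].
have [i1 E1] := key j1 j1J; have [i2 E2] := key j2 j2J.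
have zq (k : nat) : (z ^+ k) ^+ q = 1 by rewrite exprAC (prim_expr_order zP) expr1n.
have n12 : z ^+ i1.+1 != z ^+ i2.+1.
  apply: contraNneq j12 => i12; apply/eqP/unity_rho_inj.
  by rewrite /unity_rho -E1 -E2 i12.
have zz : z ^+ i2.+1 = z ^+ j2.+1.
  apply: (rigid (zq i1.+1) (zq i2.+1) (zq j1.+1) (zq j2.+1)) => //.
  - exact: unity_neq1.
  - exact: unity_neq1.
  by rewrite -E1 -E2; ring.
apply: (mulIf (unity_sub_neq0 i2)).
by rewrite E2 mul1r zz.
Qed.

End UnityRoots.

End UnityRigidity.

(** * Finiteness *)

Section Finiteness.
Local Open Scope ring_scope.
Local Open Scope card_scope.

Lemma seq_outside (T : choiceType) (t : T) (A : set T) n (l : seq T) :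
  ~~ (A #<= `I_n) -> (size l <= n)%N -> exists2 x, A x & x \notin l.
Proof.
move=> nA ln; apply: contrapT => nx; case/negP: nA.
apply: (card_le_trans _ (card_image_le (nth t l) `I_n)).
apply: subset_card_le => x Ax; exists (index x l); last first.
  by rewrite nth_index //; apply: contrapT => /negP xl; apply: nx; exists x.
rewrite /= (leq_trans _ ln) // index_mem.
by apply: contrapT => /negP xl; apply: nx; exists x.
Qed.

(** * Affine change of the coordinate x *)

Section Affine.
Variables (K : closedFieldType) (C : curve K) (P : point C) (x y : C).
Variables (f : {poly K}) (m : nat).
Hypothesis M : is_model P x y f m.
Variables (b d r : K).
Hypotheses (d0 : d != 0) (r2 : r ^+ 2 = d ^+ (2 * m + 1)).

Definition affine_poly (p : {poly K}) : {poly K} := p \Po (d *: 'X + b%:P).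
(** The equation for (x - b) / d and y / r. With r^2 = d^(2m + 1) the power (X - b')^q in an
    expression of f keeps the coefficient 1. *)
Definition affine_model : {poly K} := (d ^+ (2 * m + 1))^-1 *: affine_poly f.

Lemma size_affine_poly p : size (affine_poly p) = size p.
Proof.
rewrite size_comp_poly2 // size_polyDl size_scale // ?size_polyX //.
by rewrite (leq_ltn_trans (size_polyC_leq1 _)).
Qed.

Lemma affine_is_model :
  is_model P ((x - cst C b) / cst C d) (y / cst C r) affine_model m.
Proof.
have r0 : r != 0 by rewrite -sqrf_eq0 r2 expf_neq0.
have dC : cst C d != 0 by rewrite fmorph_eq0.
have rC : cst C r != 0 by rewrite fmorph_eq0.
have ev_affine p : ev ((x - cst C b) / cst C d) (affine_poly p) = ev x p.
  by rewrite ev_comp evD evZ evX evC mulrCA mulfV // mulr1 subrK.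
split.
- have -> : (x - cst C b) / cst C d = ev x (d^-1 *: ('X - b%:P)).
    by rewrite evZ evXsubC fmorphV mulrC.
  have [|_ ->] := place_ev_pole (p := d^-1 *: ('X - b%:P)) (model_pole M).
    by rewrite scaler_eq0 invr_eq0 (negbTE d0) polyXsubC_eq0.
  by rewrite size_scale ?invr_eq0 // size_XsubC mulr1n (model_pole M).
- rewrite exprMn exprVn -rmorphXn r2 /affine_model evZ ev_affine (model_eq M).
  by rewrite mulrC fmorphV.
- by rewrite size_scale ?invr_eq0 ?expf_neq0 // size_affine_poly (model_size M).
move=> h; have [A [B [e [e0 he]]]] := model_gen M h.
exists (affine_poly A), (r *: affine_poly B), (affine_poly e); split.
  by rewrite -size_poly_eq0 size_affine_poly size_poly_eq0.
by rewrite /evy evZ !ev_affine he /evy; congr (_ + _); field.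
Qed.

Lemma affine_power_sum b' v : f = ('X - b'%:P) ^+ (2 * m + 1) + v ^+ 2 ->
  affine_model = ('X - ((b' - b) / d)%:P) ^+ (2 * m + 1) + (r^-1 *: affine_poly v) ^+ 2.
Proof.
move=> fE; rewrite /affine_model fE /affine_poly comp_polyD !rmorphXn /= scalerDr.
congr (_ + _); last by rewrite exprZn exprVn r2.
rewrite -exprVn -exprZn; congr (_ ^+ _).
rewrite comp_polyB comp_polyX comp_polyC -addrA -polyCB scalerDr scalerA mulVf // scale1r.
by rewrite -mul_polyC -polyCM -polyCN; congr (_ + _%:P); field.
Qed.

End Affine.

(** * From more than four points of order q to three abscissae *)

Section ThreePoints.
Variables (K : closedFieldType) (C : curve K) (P : point C) (x y : C).
Variables (f : {poly K}) (m : nat).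
Hypotheses (M : is_model P x y f m) (sqf : squarefree f) (fmonic : f \is monic).
Hypotheses (two : 2%:R != 0 :> K) (m0 : (0 < m)%N).
Local Notation q := (2 * m + 1)%N.

Definition power_sum b (v : {poly K}) := (size v <= m.+1)%N /\ f = ('X - b%:P) ^+ q + v ^+ 2.

Lemma power_sum_value b v : power_sum b v -> v.[b] ^+ 2 = f.[b].
Proof.
by move=> [_ ->]; rewrite !hornerE subrr expr0n addn1 add0r.
Qed.

(** All expressions of f with the same b have the same v(b)^2 = f(b), so the points are (b, v(b))
    and (b, - v(b)). *)
Lemma points_above b : exists2 l : seq (point C), (size l <= 2)%N &
  forall Q v, power_sum b v -> centered x y b v.[b] Q -> Q \in l.
Proof.
have [[v vb]|nv] := pselect (exists v, power_sum b v); last first.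
  by exists [::] => // Q v vb; case: nv; exists v.
have bc := power_sum_value vb.
have bcN : (- v.[b]) ^+ 2 = f.[b] by rewrite sqrrN.
have [Q1 Q1c] := centered_exists M sqf two bc.
have [Q2 Q2c] := centered_exists M sqf two bcN.
exists [:: Q1; Q2] => // Q v' vb' Qc.
have bc' := power_sum_value vb'.
have : v'.[b] ^+ 2 == v.[b] ^+ 2 by rewrite bc bc'.
rewrite eqf_sqr !inE => /orP[] /eqP e; rewrite e in Qc.
  by rewrite (centered_uniq M sqf two bc Qc Q1c) eqxx.
by rewrite (centered_uniq M sqf two bcN Qc Q2c) eqxx orbT.
Qed.

Lemma three_abscissae : ~~ (points_of_order P q #<= `I_4) ->
  exists b1 b2 b3 v1 v2 v3, [/\ [/\ b1 != b2, b1 != b3 & b2 != b3],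
    power_sum b1 v1, power_sum b2 v2 & power_sum b3 v3].
Proof.
move=> many.
have next l : (size l <= 4)%N -> exists Q b v,
    [/\ Q \notin l, power_sum b v & centered x y b v.[b] Q].
  move=> l4; have [Q Qo Ql] := seq_outside P many l4.
  have [b [v [sv fE Qc]]] := torsion_point M sqf two fmonic m0 Qo.
  by exists Q, b, v.
have [Q1 [b1 [v1 [_ S1 C1]]]] := next [::] isT.
have [l1 l1s l1P] := points_above b1.
have [|Q2 [b2 [v2 [N2 S2 C2]]]] := next l1; first by rewrite (leq_trans l1s).
have [l2 l2s l2P] := points_above b2.
have [|Q3 [b3 [v3 [N3 S3 C3]]]] := next (l1 ++ l2).
  by rewrite size_cat (leq_add l1s l2s).
rewrite mem_cat negb_or in N3; have [N31 N32] := andP N3.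
exists b1, b2, b3, v1, v2, v3; split=> //; split.
- by apply: contraNneq N2 => b12; rewrite -b12 in S2 C2; apply: l1P C2.
- by apply: contraNneq N31 => b13; rewrite -b13 in S3 C3; apply: l1P C3.
- by apply: contraNneq N32 => b23; rewrite -b23 in S3 C3; apply: l2P C3.
Qed.

End ThreePoints.

Definition modelled (K : closedFieldType) g (C : marked_curve K g) (f : {poly K}) :=
  exists x y, is_model (mpoint C) x y f g.

(** Only a polynomial that is the equation of some marked curve gets a representative, so no curve
    has to be built from an equation. *)
Lemma representatives (K : closedFieldType) g (fs : seq {poly K}) :
  exists S : seq (marked_curve K g), (size S <= size fs)%N /\
  forall (C : marked_curve K g) f, f \in fs -> modelled C f ->
    exists2 C', List.In C' S & modelled C' f.
Proof.
elim: fs => [|f fs [S [sS SP]]]; first by exists [::].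
have [[C Cf]|nC] := pselect (exists C : marked_curve K g, modelled C f).
  exists (C :: S); split=> // C' f'; rewrite in_cons => /orP[/eqP->|f'fs] C'f'.
    by exists C => //; left.
  by have [C'' ? ?] := SP C' f' f'fs C'f'; exists C'' => //; right.
exists S; split; first exact: leqW.
move=> C f'; rewrite in_cons => /orP[/eqP->|f'fs] Cf'; last exact: SP Cf'.
by case: nC; exists C.
Qed.

(** q - 1 is prime to q, so some power of the primitive root p is -1 mod q. Since p is odd and prime
    to q, neither 2 nor q vanishes in [K]. *)
Lemma rigid_characteristic (K : closedFieldType) (g : nat) : (1 < g)%N ->
  ([pchar K] =i pred0 \/
   (prime (2 * g + 1) /\
    exists p : nat, [/\ p \in [pchar K], odd p & primitive_root_mod p (2 * g + 1)])) ->
  [/\ 2%:R != 0 :> K, (2 * g + 1)%:R != 0 :> K & unity_rigid K (2 * g + 1)].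
Proof.
move=> g1 [K0|[_ [p [pK op [pq prim]]]]].
  by split; rewrite ?((pcharf0P K).1 K0) ?addn1 //; apply: char0_rigid.
have pp := pcharf_prime pK; split.
- rewrite -(dvdn_pcharf pK); apply/negP => /dvdn_leq => /(_ isT).
  by move: op (prime_gt1 pp); case: p {pK pq prim pp} => [|[|[|p]]].
- rewrite -(dvdn_pcharf pK); apply: contraTN pq => /gcdn_idPl.
  by rewrite /coprime => ->; rewrite gtn_eqF // prime_gt1.
have [|k pk] := prim (2 * g + 1).-1; first by rewrite coprimePn // addn1.
by apply: (Frobenius_power_rigid (k := k)) pK pk; rewrite addn1.
Qed.

End Finiteness.

Local Open Scope classical_set_scope.
Local Open Scope card_scope.

Theorem theorem1 (K : closedFieldType) (g : nat) (g_gt1 : (1 < g)%N)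
  (hyp : [pchar K]%R =i pred0 \/
         (prime (2 * g + 1)%N /\
          exists p : nat, [/\ p \in [pchar K]%R, odd p &
                              primitive_root_mod p (2 * g + 1)%N])) :
  exists S : seq (marked_curve K g),
    (size S <= 9 * (4 * g - 1) * 'C(2 * g, g) ^ 2)%N /\
    forall C : marked_curve K g,
      ~~ (points_of_order (mpoint C) (2 * g + 1)%N #<= `I_4) ->
      exists2 C' : marked_curve K g, List.In C' S & marked_iso C C'.
Proof.
have [two qK rigid] := rigid_characteristic g_gt1 hyp.
have [z zP] := prim_root_exists qK.
have [fs sfs fsP] := cover_three_abscissae g_gt1 two qK (unity_rho_inj zP)
  (unity_rho_root zP) (unity_circle g_gt1 zP rigid).
have [S [sS SP]] := representatives g fs.
exists S; split.
  rewrite (leq_trans sS) // (leq_trans sfs) // leq_mul2r; apply/orP; right.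
  by clear -g_gt1; lia.
move=> C many.
have [x [y [f [m [M sqf fmonic]]]]] : exists x y f m,
    [/\ is_model (mpoint C) x y f m, squarefree f & f \is monic]%R.
  by case: C {many} => C P gC wP; apply: (hyperelliptic_model two wP).
have gm : g = m by case: C x y M many => C P gC wP /= x y M _; apply: (genus_model M sqf two gC).
subst m.
have [b1 [b2 [b3 [v1 [v2 [v3 [[b12 b13 b23] [s1 e1] [s2 e2] [s3 e3]]]]]]]] :=
  three_abscissae M sqf fmonic two (ltnW g_gt1) many.
(* The affine map takes b1, b2, b3 to 0, 1 and (b3 - b1) / (b2 - b1), which plays the part of a. *)
pose d : K := (b2 - b1)%R.
have d0 : (d != 0)%R by rewrite subr_eq0 eq_sym.
have [r r2] := exists_sqrt (d ^+ (2 * g + 1))%R.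
have M' := affine_is_model M b1 d0 r2.
have E1 := affine_power_sum b1 d0 r2 e1.
have E2 := affine_power_sum b1 d0 r2 e2.
have E3 := affine_power_sum b1 d0 r2 e3.
rewrite subrr mul0r subr0 in E1; rewrite divff // in E2.
have sv (v : {poly K}) : (size v <= g.+1)%N ->
    (size (r^-1 *: affine_poly b1 d v)%R <= g.+1)%N.
  by move=> ?; rewrite (leq_trans (size_scale_leq _ _)) // size_affine_poly.
have f'fs : affine_model f g b1 d \in fs.
  rewrite E1; apply: (fsP _ _ _ ((b3 - b1) / d)%R (sv _ s1) (sv _ s2) (sv _ s3)).
  - by rewrite mulf_neq0 ?invr_eq0 // subr_eq0 eq_sym.
  - by apply: contraNneq b23 => /(canRL (divfK d0)); rewrite mul1r => /addIr->.
  - by rewrite -E1.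
  - by rewrite -E1.
have [C' C'S [x' [y' MC']]] := SP C _ f'fs (ex_intro _ _ (ex_intro _ _ M')).
by exists C' => //; apply: model_marked_iso M' MC'.
Qed.
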